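(* Let $\mathcal{H}$ be a quasitriangular Hopf algebra with the universal R-matrix $\mathcal{R}$, and let $\mathcal{Q}=\mathcal{R}_{21}\mathcal{R}=\mathcal{Q}_1\otimes\mathcal{Q}_2\in\mathcal{H}^{\otimes2}$. Then the map $\tilde{\mathcal{H}}^*\to\mathcal{H}$ defined by $$\eta\mapsto\langle\eta,\mathcal{Q}_1\rangle\,\mathcal{Q}_2,\qquad\eta\in\tilde{\mathcal{H}}^*,$$ where $\langle\,\cdot\,,\,\cdot\,\rangle$ is the Hopf pairing between $\mathcal{H}^*$ and $\mathcal{H}$, is a homomorphism of $\mathcal{H}$-module algebras, from $\tilde{\mathcal{H}}^*$ with the coadjoint action of $\mathcal{H}$ to $\mathcal{H}$ with the adjoint action.
   Context: Conventions: $\mathbb{K}$ is a commutative algebra over a field of zero characteristic and Hopf algebras are over $\mathbb{K}$, with coproduct $\Delta$, counit $\varepsilon$, antipode $\gamma$. In the infinite dimensional case all algebras are assumed complete in some topology (e.g. $h$-adic) and tensor products are completed. Summation is implicit: $\Delta(x)=x_{(1)}\otimes x_{(2)}$, $\mathcal{R}=\mathcal{R}_1\otimes\mathcal{R}_2$; primes distinguish copies; $\mathcal{R}_{21}=\mathcal{R}_2\otimes\mathcal{R}_1$. $\mathcal{H}$ is quasitriangular with universal R-matrix $\mathcal{R}\in\mathcal{H}^{\otimes 2}$ (invertible) if $(\Delta\otimes\mathrm{id})(\mathcal{R})=\mathcal{R}_{13}\mathcal{R}_{23}$, $(\mathrm{id}\otimes\Delta)(\mathcal{R})=\mathcal{R}_{13}\mathcal{R}_{12}$,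 $\mathcal{R}\Delta(x)=\Delta^{op}(x)\mathcal{R}$. $\mathcal{H}^*$ is the dual Hopf algebra, spanned by matrix coefficients of all finite dimensional representations of $\mathcal{H}$ (assumed to separate elements of $\mathcal{H}$). It is an $\mathcal{H}$-bimodule algebra under the coregular actions $x\triangleright a=a_{(1)}\langle a_{(2)},x\rangle$, $a\triangleleft x=\langle a_{(1)},x\rangle a_{(2)}$. The reflection equation dual $\tilde{\mathcal{H}}^*$ is $\mathcal{H}^*$ as a vector space with the associative multiplication $$\tilde m(a\otimes b)=m\bigl(\mathcal{R}_1\triangleright a\triangleleft\mathcal{R}_{1'}\otimes b\triangleleft\gamma(\mathcal{R}_2)\triangleleft\mathcal{R}_{2'}\bigr),$$ $m$ being the multiplication of $\mathcal{H}^*$. The coadjoint action of $x\in\mathcal{H}$ on $\eta\in\tilde{\mathcal{H}}^*$ is $\eta\mapsto x_{(2)}\triangleright\eta\triangleleft\gamma(x_{(1)})$, and the adjoint action of $\mathcal{H}$ on itself is $\mathrm{ad}(x)\triangleright y=x_{(1)}\,y\,\gamma(x_{(2)})$; these make $\tilde{\mathcal{H}}^*$ and $\mathcal{H}$ left $\mathcal{H}$-module algebras. *)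

(* Defs.v *)
From HB Require Import structures.
From mathcomp Require Import all_boot all_order all_algebra.
From mathcomp Require Import generic_quotient.
From mathcomp Require Import boolp classical_sets functions.

Set Implicit Arguments.
Unset Strict Implicit.
Unset Printing Implicit Defensive.

Import GRing.Theory.
Local Open Scope quotient_scope.
Local Open Scope classical_set_scope.
Local Open Scope ring_scope.

(* Every ring and algebra below carries a linear topology, given by a          *)
(* fundamental system [opn] of open two-sided ideals, for which it is          *)
(* separated and complete (Cauchy families indexed by [opn] converge).         *)
(* The h-adic topology is [opn = {h^n A}]; the discrete one is [opn = {{0}}],  *)
(* and then every completed tensor product below is the algebraic one and      *)
(* all the continuity conditions are void.                                     *)
Record complete_ideal_topology (A : pzRingType) (opn : set (set A)) : Prop :=
  CompleteIdealTopology {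
    ideal_ex : exists U, opn U;
    ideal_cap : forall U V, opn U -> opn V ->
      exists2 W, opn W & W `<=` U `&` V;
    ideal0 : forall U, opn U -> U 0;
    idealD : forall U x y, opn U -> U x -> U y -> U (x + y);
    idealMl : forall U a x, opn U -> U x -> U (a * x);
    idealMr : forall U a x, opn U -> U x -> U (x * a);
    ideal_separated : forall x, (forall U, opn U -> U x) -> x = 0;
    ideal_complete : forall x : set A -> A,
      (forall U V, opn U -> opn V -> V `<=` U -> U (x U - x V)) ->
      exists y, forall U, opn U -> U (y - x U) }.

HB.mixin Record isCTRing (K : Type) of GRing.ComPzRing K := {
  ring_opn : set (set K);
  ring_opnP : complete_ideal_topology ring_opn
}.

#[short(type="ctRingType")]
HB.structure Definition CTRing := {K of GRing.ComPzRing K & isCTRing K}.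

(* Complete topological K-algebras. The library's [algType K] requires 1 != 0, *)
(* but a tensor product of two nonzero K-algebras may vanish, hence a mixin    *)
(* over [pzRingType].                                                          *)
HB.mixin Record isCTAlg (K : ctRingType) (A : Type)
    of GRing.PzRing A := {
  ctscale : K -> A -> A;
  ctscaleA : forall (c d : K) (x : A),
    ctscale c (ctscale d x) = ctscale (c * d) x;
  ctscale1 : left_id 1 ctscale;
  ctscaleDr : right_distributive ctscale +%R;
  ctscaleDl : forall x : A, {morph ctscale^~ x : c d / c + d >-> c + d};
  ctscaleAl : forall (c : K) (x y : A), ctscale c (x * y) = ctscale c x * y;
  ctscaleAr : forall (c : K) (x y : A), ctscale c (x * y) = x * ctscale c y;
  opn : set (set A);
  opnP : complete_ideal_topology opn;
  ctscale_continuous : forall U, opn U -> exists2 I, @ring_opn K I &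
    forall (c : K) (x : A), I c -> U (ctscale c x)
}.

#[short(type="ctAlgType")]
HB.structure Definition CTAlg (K : ctRingType) :=
  {A of GRing.PzRing A & isCTAlg K A}.

HB.instance Definition _ (K : ctRingType) (A : ctAlgType K) :=
  GRing.Zmodule_isLmodule.Build K (CTAlg.sort A)
    (@ctscaleA K A) (@ctscale1 K A) (@ctscaleDr K A) (@ctscaleDl K A).

Section Regular.
Variable K : ctRingType.

Lemma regular_scaleAr (c : K) (x y : K^o) : c *: (x * y) = x * (c *: y).
Proof. by rewrite /GRing.scale /= mulrCA. Qed.

Lemma regular_scaleAl (c : K) (x y : K^o) : c *: (x * y) = (c *: x) * y.
Proof. by rewrite /GRing.scale /= mulrA. Qed.

Lemma regular_scale_continuous (U : set K^o) : @ring_opn K U ->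
  exists2 I, @ring_opn K I & forall (c : K) (x : K^o), I c -> U (c *: x).
Proof.
move=> oU; exists U => // c x Uc.
by apply: (@idealMr K _ (@ring_opnP K) U x c).
Qed.

HB.instance Definition _ := isCTAlg.Build K K^o (@scalerA K K^o)
  (@scale1r K K^o) (@scalerDr K K^o) (@scalerDl K K^o) regular_scaleAl regular_scaleAr (@ring_opnP K)
 regular_scale_continuous.
End Regular.

Section OpnTheory.
Variables (K : ctRingType) (A : ctAlgType K).
Implicit Types (U V : set A) (x y : A).

Lemma opn0 U : opn U -> U 0.
Proof. exact: (ideal0 (@opnP K A)). Qed.

Lemma opnD U x y : opn U -> U x -> U y -> U (x + y).
Proof. exact: (idealD (@opnP K A)). Qed.

Lemma opnMl U a x : opn U -> U x -> U (a * x).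
Proof. exact: (idealMl (@opnP K A)). Qed.

Lemma opnMr U a x : opn U -> U x -> U (x * a).
Proof. exact: (idealMr (@opnP K A)). Qed.

Lemma opnN U x : opn U -> U x -> U (- x).
Proof. by move=> oU Ux; rewrite -mulN1r; apply: opnMl. Qed.

Lemma opnB U x y : opn U -> U x -> U y -> U (x - y).
Proof. by move=> oU Ux Uy; apply: opnD => //; apply: opnN. Qed.

Lemma opnZ U (c : K) x : opn U -> U x -> U (c *: x).
Proof.
by move=> oU Ux; rewrite -[x]mul1r [_ *: _]ctscaleAl; apply: opnMl.
Qed.

Lemma opn_sum U (I : Type) (s : seq I) (F : I -> A) :
  opn U -> (forall i, U (F i)) -> U (\sum_(i <- s) F i).
Proof.
move=> oU UF; elim/big_ind : _ => [|x y|//]; first exact: opn0.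
exact: opnD.
Qed.
End OpnTheory.

Section Algebra.
Variables (K : ctRingType) (A : ctAlgType K).

Lemma ctscalerAl (c : K) (x y : A) : c *: (x * y) = (c *: x) * y.
Proof. exact: ctscaleAl. Qed.

Lemma ctscalerAr (c : K) (x y : A) : c *: (x * y) = x * (c *: y).
Proof. exact: ctscaleAr. Qed.
End Algebra.

Section TensorCongruence.
Variables (K : ctRingType) (A B : ctAlgType K).
Implicit Types (s t : seq (A * B)) (U : set A) (V : set B).

Definition bilinear_map (P : lmodType K) (f : A -> B -> P) : Prop :=
  (forall a, linear (f a)) /\ (forall b, linear (f^~ b)).

(* The finite sums of pure tensors represented by s and t agree in             *)
(* A/U (x)_K B/V: they have the same value under every K-bilinear map on       *)
(* A x B that factors through A/U x B/V.                                       *)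
Definition tcong U V s t : Prop :=
  forall (P : lmodType K) (f : A -> B -> P), bilinear_map f ->
    (forall a b, U a -> f a b = 0) -> (forall a b, V b -> f a b = 0) ->
    \sum_(p <- s) f p.1 p.2 = \sum_(p <- t) f p.1 p.2.

Definition smul s t := [seq (p.1 * q.1, p.2 * q.2) | p <- s, q <- t].
Definition sopp s := [seq (- p.1, p.2) | p <- s].
Definition sscale (c : K) s := [seq (c *: p.1, p.2) | p <- s].

Lemma tcong_refl U V s : tcong U V s s. Proof. by []. Qed.

Lemma tcong_sym U V s t : tcong U V s t -> tcong U V t s.
Proof. by move=> st P f bf Uf Vf; rewrite (st P f). Qed.

Lemma tcong_trans U V s t r : tcong U V s t -> tcong U V t r -> tcong U V s r.
Proof. by move=> st tr P f bf Uf Vf; rewrite (st P f) // (tr P f). Qed.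

Lemma tcong_sub U U' V V' s t :
  U' `<=` U -> V' `<=` V -> tcong U' V' s t -> tcong U V s t.
Proof.
by move=> UU VV st P f bf Uf Vf; apply: st => // a b => [/UU/Uf|/VV/Vf].
Qed.

Lemma tcong_cat U V s s' t t' : tcong U V s s' -> tcong U V t t' ->
  tcong U V (s ++ t) (s' ++ t').
Proof.
by move=> ss tt P f bf Uf Vf; rewrite !big_cat /= (ss P f) // (tt P f).
Qed.

Section Bil.
Variables (P : lmodType K) (f : A -> B -> P).
Hypothesis bf : bilinear_map f.

Lemma bilZl c a b : f (c *: a) b = c *: f a b.
Proof. by have := scalable_linear (bf.2 b) c a. Qed.
Lemma bilZr c a b : f a (c *: b) = c *: f a b.
Proof. by have := scalable_linear (bf.1 a) c b. Qed.
Lemma bilDl a a' b : f (a + a') b = f a b + f a' b.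
Proof. by have := bf.2 b 1 a a'; rewrite !scale1r. Qed.
Lemma bilDr a b b' : f a (b + b') = f a b + f a b'.
Proof. by have := bf.1 a 1 b b'; rewrite !scale1r. Qed.
Lemma bilNl a b : f (- a) b = - f a b.
Proof. by rewrite -[- a]scaleN1r bilZl scaleN1r. Qed.

Lemma sum_sopp s :
  \sum_(p <- sopp s) f p.1 p.2 = - \sum_(p <- s) f p.1 p.2.
Proof. by rewrite big_map -sumrN; apply: eq_bigr => p _; rewrite bilNl. Qed.

Lemma sum_sscale c s :
  \sum_(p <- sscale c s) f p.1 p.2 = c *: \sum_(p <- s) f p.1 p.2.
Proof. by rewrite big_map scaler_sumr; apply: eq_bigr => p _; rewrite bilZl. Qed.

Lemma sum_smul s t : \sum_(p <- smul s t) f p.1 p.2 =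
  \sum_(p <- s) \sum_(q <- t) f (p.1 * q.1) (p.2 * q.2).
Proof. by rewrite big_allpairs_dep. Qed.
End Bil.

Lemma tcong_opp U V s s' : tcong U V s s' -> tcong U V (sopp s) (sopp s').
Proof. by move=> ss P f bf Uf Vf; rewrite !sum_sopp // (ss P f). Qed.

Lemma tcong_scale U V c s s' :
  tcong U V s s' -> tcong U V (sscale c s) (sscale c s').
Proof. by move=> ss P f bf Uf Vf; rewrite !sum_sscale // (ss P f). Qed.

Lemma tcong_mul U V s s' t t' : opn U -> opn V ->
  tcong U V s s' -> tcong U V t t' -> tcong U V (smul s t) (smul s' t').
Proof.
move=> oU oV ss tt P f bf Uf Vf; rewrite !sum_smul //.
rewrite (ss P (fun a b => \sum_(q <- t) f (a * q.1) (b * q.2))).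
- apply: eq_bigr => p _; apply: (tt P (fun a b => f (p.1 * a) (p.2 * b))).
  + split=> [a c b b'|b c a a'].
    * by rewrite mulrDr -ctscalerAr bilDr // bilZr.
    * by rewrite mulrDr -ctscalerAr bilDl // bilZl.
  + by move=> a b Ua; apply: Uf; apply: opnMl.
  + by move=> a b Vb; apply: Vf; apply: opnMl.
- split=> [a c b b'|b c a a']; rewrite scaler_sumr -big_split /=;
    apply: eq_bigr => q _.
  + by rewrite mulrDl -ctscalerAl bilDr // bilZr.
  + by rewrite mulrDl -ctscalerAl bilDl // bilZl.
- by move=> a b Ua; rewrite big1 // => q _; apply: Uf; apply: opnMr.
- by move=> a b Vb; rewrite big1 // => q _; apply: Vf; apply: opnMr.
Qed.

(* The completed tensor product is the inverse limit of the A/U (x)_K B/V:     *)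
(* an element is a coherent family of finite sums of pure tensors, one for     *)
(* each pair of open ideals, up to termwise congruence.                        *)
Definition coherent (f : set A -> set B -> seq (A * B)) : Prop :=
  forall U U' V V', opn U -> opn U' -> opn V -> opn V' ->
    U' `<=` U -> V' `<=` V -> tcong U V (f U' V') (f U V).

Record tnet := TNet { net :> set A -> set B -> seq (A * B);
                      netP : coherent net }.

HB.instance Definition _ := gen_eqMixin tnet.
HB.instance Definition _ := gen_choiceMixin tnet.

Definition net_eq (f g : tnet) : bool :=
  `[< forall U V, opn U -> opn V -> tcong U V (f U V) (g U V) >].

Lemma net_eq_refl : reflexive net_eq.
Proof. by move=> f; apply/asboolP => U V _ _; apply: tcong_refl. Qed.

Lemma net_eq_sym : symmetric net_eq.
Proof.
by move=> f g; apply/asboolP/asboolP => fg U V oU oV;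
  apply: tcong_sym; apply: fg.
Qed.

Lemma net_eq_trans : transitive net_eq.
Proof.
move=> g f h /asboolP fg /asboolP gh; apply/asboolP => U V oU oV.
exact: tcong_trans (fg _ _ oU oV) (gh _ _ oU oV).
Qed.

Canonical net_equiv := EquivRel net_eq net_eq_refl net_eq_sym net_eq_trans.

Definition ctensor := {eq_quot net_eq}.

HB.instance Definition _ := Choice.on ctensor.

Definition component (x : ctensor) U V : seq (A * B) := net (repr x) U V.

Definition of_net f (cf : coherent f) : ctensor := \pi_ctensor (TNet cf).

Definition admissible U V (P : lmodType K) (f : A -> B -> P) : Prop :=
  [/\ bilinear_map f, forall a b, U a -> f a b = 0
                    & forall a b, V b -> f a b = 0].

Definition tval U V (P : lmodType K) (f : A -> B -> P) (x : ctensor) : P :=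
  \sum_(p <- component x U V) f p.1 p.2.

Lemma of_netE f (cf : coherent f) U V (P : lmodType K) (g : A -> B -> P) :
  opn U -> opn V -> admissible U V g ->
  tval U V g (of_net cf) = \sum_(p <- f U V) g p.1 p.2.
Proof.
move=> oU oV [bg Ug Vg]; rewrite /tval /component.
have /asboolP e : net_eq (repr (of_net cf)) (TNet cf).
  by apply/eqmodP; rewrite reprK.
exact: e.
Qed.

Lemma ctensorP (x y : ctensor) :
  (forall U V (P : lmodType K) (g : A -> B -> P), opn U -> opn V ->
     admissible U V g -> tval U V g x = tval U V g y) -> x = y.
Proof.
move=> e; rewrite -[x]reprK -[y]reprK; apply/eqmodP/asboolP.
by move=> U V oU oV P g bg Ug Vg; apply: e.
Qed.

Lemma component_coherent (x : ctensor) : coherent (component x).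
Proof. exact: netP. Qed.

Lemma tval_sub U U' V V' (P : lmodType K) (g : A -> B -> P) x :
  opn U -> opn U' -> opn V -> opn V' -> U' `<=` U -> V' `<=` V ->
  admissible U V g -> tval U' V' g x = tval U V g x.
Proof.
by move=> oU oU' oV oV' UU VV [*]; apply: component_coherent.
Qed.

Lemma zero_coherent : coherent (fun _ _ => [::]).
Proof. by []. Qed.

Lemma one_coherent : coherent (fun _ _ => [:: (1, 1)]).
Proof. by []. Qed.

Lemma pure_coherent a b : coherent (fun _ _ => [:: (a, b)]).
Proof. by []. Qed.

Lemma opp_coherent x : coherent (fun U V => sopp (component x U V)).
Proof. by move=> *; apply: tcong_opp; apply: component_coherent. Qed.

Lemma scale_coherent c x : coherent (fun U V => sscale c (component x U V)).
Proof. by move=> *; apply: tcong_scale; apply: component_coherent. Qed.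

Lemma add_coherent x y :
  coherent (fun U V => component x U V ++ component y U V).
Proof. by move=> *; apply: tcong_cat; apply: component_coherent. Qed.

Lemma mul_coherent x y :
  coherent (fun U V => smul (component x U V) (component y U V)).
Proof. by move=> *; apply: tcong_mul => //; apply: component_coherent. Qed.

Definition pure_tensor a b := of_net (pure_coherent a b).
Definition tzero := of_net zero_coherent.
Definition tone := of_net one_coherent.
Definition topp x := of_net (opp_coherent x).
Definition tscale c x := of_net (scale_coherent c x).
Definition tadd x y := of_net (add_coherent x y).
Definition tmul x y := of_net (mul_coherent x y).

Section Values.
Variables (U : set A) (V : set B) (P : lmodType K) (g : A -> B -> P).
Hypotheses (oU : opn U) (oV : opn V) (ag : admissible U V g).
Let bg : bilinear_map g. Proof. by case: ag. Qed.

Lemma tval_zero : tval U V g tzero = 0.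
Proof. by rewrite of_netE // big_nil. Qed.

Lemma tval_one : tval U V g tone = g 1 1.
Proof. by rewrite of_netE // big_seq1. Qed.

Lemma tval_pure a b : tval U V g (pure_tensor a b) = g a b.
Proof. by rewrite of_netE // big_seq1. Qed.

Lemma tval_opp x : tval U V g (topp x) = - tval U V g x.
Proof. by rewrite of_netE // sum_sopp. Qed.

Lemma tval_scale c x : tval U V g (tscale c x) = c *: tval U V g x.
Proof. by rewrite of_netE // sum_sscale. Qed.

Lemma tval_add x y : tval U V g (tadd x y) = tval U V g x + tval U V g y.
Proof. by rewrite of_netE // big_cat. Qed.

Lemma tval_mul x y : tval U V g (tmul x y) =
  tval U V (fun a b => tval U V (fun c d => g (a * c) (b * d)) y) x.
Proof. by rewrite of_netE // sum_smul. Qed.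

Lemma admissible_mul_l c d : admissible U V (fun a b => g (a * c) (b * d)).
Proof.
case: ag => _ Ug Vg; split.
- split=> [a k b b'|b k a a'].
  + by rewrite mulrDl -ctscalerAl bilDr // bilZr.
  + by rewrite mulrDl -ctscalerAl bilDl // bilZl.
- by move=> a b Ua; apply: Ug; apply: opnMr.
- by move=> a b Vb; apply: Vg; apply: opnMr.
Qed.

Lemma admissible_mul_r c d : admissible U V (fun a b => g (c * a) (d * b)).
Proof.
case: ag => _ Ug Vg; split.
- split=> [a k b b'|b k a a'].
  + by rewrite mulrDr -ctscalerAr bilDr // bilZr.
  + by rewrite mulrDr -ctscalerAr bilDl // bilZl.
- by move=> a b Ua; apply: Ug; apply: opnMl.
- by move=> a b Vb; apply: Vg; apply: opnMl.
Qed.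
End Values.

Lemma admissible_sum U V (P : lmodType K) I (r : seq I)
    (g : I -> A -> B -> P) : (forall i, admissible U V (g i)) ->
  admissible U V (fun a b => \sum_(i <- r) g i a b).
Proof.
move=> ag; split.
- split=> [a k b b'|b k a a']; rewrite scaler_sumr -big_split;
    apply: eq_bigr => i _; case: (ag i) => bg _ _ /=.
  + by rewrite bilDr // bilZr.
  + by rewrite bilDl // bilZl.
- by move=> a b Ua; apply: big1 => i _; case: (ag i) => _ Ug _; apply: Ug.
- by move=> a b Vb; apply: big1 => i _; case: (ag i) => _ _ Vg; apply: Vg.
Qed.

Lemma tadd_assoc : associative tadd.
Proof. by move=> x y z; apply: ctensorP => *; rewrite !tval_add // addrA. Qed.

Lemma tadd_comm : commutative tadd.
Proof. by move=> x y; apply: ctensorP => *; rewrite !tval_add // addrC. Qed.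

Lemma tadd0 : left_id tzero tadd.
Proof.
by move=> x; apply: ctensorP => *; rewrite tval_add // tval_zero // add0r.
Qed.

Lemma taddN : left_inverse tzero topp tadd.
Proof.
move=> x; apply: ctensorP => *.
by rewrite tval_add // tval_opp // tval_zero // addNr.
Qed.

HB.instance Definition _ := GRing.isZmodule.Build ctensor
  tadd_assoc tadd_comm tadd0 taddN.

Lemma tmul_assoc : associative tmul.
Proof.
move=> x y z; apply: ctensorP => U V P g oU oV ag.
rewrite [RHS]tval_mul // (tval_mul oU oV ag x (tmul y z)).
rewrite [RHS](tval_mul oU oV (admissible_sum (component z U V)
  (fun q => admissible_mul_l oU oV ag q.1 q.2)) x y).
apply: eq_bigr => p _.
rewrite (tval_mul oU oV (admissible_mul_r oU oV ag p.1 p.2) y z).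
apply: eq_bigr => q _; apply: eq_bigr => r _ /=.
by rewrite !mulrA.
Qed.

Lemma tmul1l : left_id tone tmul.
Proof.
move=> x; apply: ctensorP => U V P g oU oV ag; rewrite tval_mul //.
rewrite (@tval_one U V _ (fun a b => tval U V (fun c d => g (a * c) (b * d)) x)) //.
  by apply: eq_bigr => p _; rewrite !mul1r.
exact: admissible_sum (fun q => admissible_mul_l oU oV ag q.1 q.2).
Qed.

Lemma tmul1r : right_id tone tmul.
Proof.
move=> x; apply: ctensorP => U V P g oU oV ag; rewrite tval_mul //.
apply: eq_bigr => p _; rewrite tval_one ?mulr1 //.
exact: admissible_mul_r.
Qed.

Lemma tmulDl : left_distributive tmul tadd.
Proof.
move=> x y z; apply: ctensorP => U V P g oU oV ag.
rewrite tval_mul // !tval_add // ?tval_mul //.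
exact: admissible_sum (fun q => admissible_mul_l oU oV ag q.1 q.2).
Qed.

Lemma tmulDr : right_distributive tmul tadd.
Proof.
move=> x y z; apply: ctensorP => U V P g oU oV ag.
rewrite tval_add // !tval_mul // /tval -big_split; apply: eq_bigr => p _ /=.
by have /= := tval_add oU oV (admissible_mul_r oU oV ag p.1 p.2) y z.
Qed.

HB.instance Definition _ := GRing.Zmodule_isPzRing.Build ctensor
  tmul_assoc tmul1l tmul1r tmulDl tmulDr.

Lemma tscaleA c d x : tscale c (tscale d x) = tscale (c * d) x.
Proof. by apply: ctensorP => *; rewrite !tval_scale // scalerA. Qed.

Lemma tscale1 : left_id 1 tscale.
Proof. by move=> x; apply: ctensorP => *; rewrite tval_scale // scale1r. Qed.

Lemma tscaleDr : right_distributive tscale +%R.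
Proof.
move=> c x y; apply: ctensorP => *.
by rewrite tval_scale // !tval_add // !tval_scale // scalerDr.
Qed.

Lemma tscaleDl x : {morph tscale^~ x : c d / c + d >-> c + d}.
Proof.
by move=> c d; apply: ctensorP => *; rewrite tval_add // !tval_scale // scalerDl.
Qed.

Lemma tscaleAl c (x y : ctensor) : tscale c (x * y) = tscale c x * y.
Proof.
apply: ctensorP => U V P g oU oV ag.
rewrite tval_scale // !tval_mul // tval_scale //.
exact: admissible_sum (fun q => admissible_mul_l oU oV ag q.1 q.2).
Qed.

Lemma tscaleAr c (x y : ctensor) : tscale c (x * y) = x * tscale c y.
Proof.
apply: ctensorP => U V P g oU oV ag.
rewrite tval_scale // !tval_mul // [X in _ *: X]/tval scaler_sumr.
apply: eq_bigr => p _.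
by rewrite (tval_scale oU oV (admissible_mul_r oU oV ag p.1 p.2) c y).
Qed.

Definition tnbhs U V : set ctensor :=
  [set x | tcong U V (component x U V) [::]].

Definition topn : set (set ctensor) :=
  [set W | exists U V, [/\ opn U, opn V & W = tnbhs U V]].

Lemma tnbhsP U V x : tnbhs U V x <->
  forall (P : lmodType K) (g : A -> B -> P), admissible U V g ->
    tval U V g x = 0.
Proof.
split=> [h P g [bg Ug Vg]|h P g bg Ug Vg].
  by rewrite /tval (h P g) // big_nil.
by rewrite big_nil; apply: h.
Qed.

Lemma tnbhs_sub U U' V V' : opn U -> opn U' -> opn V -> opn V' ->
  U' `<=` U -> V' `<=` V -> tnbhs U' V' `<=` tnbhs U V.
Proof.
move=> oU oU' oV oV' UU VV x /tnbhsP h; apply/tnbhsP => P g ag.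
rewrite -(@tval_sub U U' V V') //; apply: h.
by case: ag => bg Ug Vg; split=> // a b => [/UU/Ug|/VV/Vg].
Qed.

Lemma topnP : complete_ideal_topology topn.
Proof.
split.
- have [U oU] := ideal_ex (@opnP K A); have [V oV] := ideal_ex (@opnP K B).
  by exists (tnbhs U V), U, V.
- move=> _ _ [U1 [V1 [oU1 oV1 ->]]] [U2 [V2 [oU2 oV2 ->]]].
  have [U oU Us] := ideal_cap (@opnP K A) oU1 oU2.
  have [V oV Vs] := ideal_cap (@opnP K B) oV1 oV2.
  exists (tnbhs U V); first by exists U, V.
  by move=> x xUV; split; move: x xUV; apply: tnbhs_sub => // x =>
  [/Us[]|/Vs[]].
- move=> _ [U [V [oU oV ->]]]; apply/tnbhsP => P g ag; exact: tval_zero.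
- move=> _ x y [U [V [oU oV ->]]] /tnbhsP hx /tnbhsP hy.
  by apply/tnbhsP => P g ag; rewrite [LHS]tval_add // hx // hy // addr0.
- move=> _ x y [U [V [oU oV ->]]] /tnbhsP hy; apply/tnbhsP => P g ag.
  rewrite [LHS]tval_mul //; apply: big1 => p _.
  exact: (hy P _ (admissible_mul_r oU oV ag p.1 p.2)).
- move=> _ y x [U [V [oU oV ->]]] /tnbhsP hx; apply/tnbhsP => P g ag.
  rewrite [LHS]tval_mul //; apply: hx.
  exact: admissible_sum (fun q => admissible_mul_l oU oV ag q.1 q.2).
- move=> x h; apply: ctensorP => U V P g oU oV ag.
  rewrite [RHS]tval_zero //; move: P g ag; apply/tnbhsP; apply: h.
  by exists U, V.
- move=> x cx.
  have cy : coherent (fun U V => component (x (tnbhs U V)) U V).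
    move=> U U' V V' oU oU' oV oV' UU VV P g bg Ug Vg.
    have ag : admissible U V g by [].
    have h : tnbhs U V (x (tnbhs U V) - x (tnbhs U' V')).
      apply: cx; [by exists U, V|by exists U', V'|exact: tnbhs_sub].
    move/tnbhsP: h => /(_ P g ag); rewrite [LHS]tval_add //.
    rewrite [X in _ + X]tval_opp // => /eqP; rewrite subr_eq0 => /eqP e.
    rewrite -/(tval U V g _) e -(@tval_sub U U' V V') //.
  exists (of_net cy) => _ [U [V [oU oV ->]]]; apply/tnbhsP => P g ag.
  rewrite [LHS]tval_add // [X in _ + X]tval_opp // of_netE //.
  exact: subrr.
Qed.

Lemma tscale_continuous W : topn W -> exists2 I, @ring_opn K I &
  forall c x, I c -> W (tscale c x).
Proof.
move=> [U [V [oU oV ->]]]; have [I oI sI] := ctscale_continuous U oU.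
exists I => // c x Ic; apply/tnbhsP => P g ag.
rewrite of_netE // big_map; apply: big1 => p _; case: ag => _ Ug _.
by apply: Ug; apply: sI.
Qed.

HB.instance Definition _ := GRing.Zmodule_isLmodule.Build K ctensor
  tscaleA tscale1 tscaleDr tscaleDl.

HB.instance Definition _ := isCTAlg.Build K ctensor tscaleA tscale1
  tscaleDr tscaleDl tscaleAl tscaleAr topnP tscale_continuous.

End TensorCongruence.

Notation "A '\ox' B" := (ctensor A%type B%type) (at level 40, left associativity)
  : type_scope.
Notation "a '\ox' b" := (pure_tensor a b) (at level 40, left associativity)
  : ring_scope.

Section Quotient.
Variables (K : ctRingType) (C : ctAlgType K) (W : set C) (oW : opn W).

Definition qeq (x y : C) : bool := `[< W (x - y) >].

Lemma qeq_refl : reflexive qeq.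
Proof. by move=> x; apply/asboolP; rewrite subrr; apply: opn0. Qed.

Lemma qeq_sym : symmetric qeq.
Proof.
by move=> x y; apply/asboolP/asboolP => h; rewrite -opprB; apply: opnN.
Qed.

Lemma qeq_trans : transitive qeq.
Proof.
move=> y x z /asboolP xy /asboolP yz; apply/asboolP.
by rewrite -(subrKA y); apply: opnD.
Qed.

Definition qequiv := EquivRel qeq qeq_refl qeq_sym qeq_trans.
Definition quot_mod := {eq_quot qequiv}.
HB.instance Definition _ := Choice.on quot_mod.

Definition qpi (x : C) : quot_mod := \pi_quot_mod x.

Lemma qpiP x y : W (x - y) <-> qpi x = qpi y.
Proof.
split=> [h|/eqmodP /asboolP //]; by apply/eqmodP/asboolP.
Qed.

Lemma qpi_ind (P : quot_mod -> Prop) : (forall x, P (qpi x)) -> forall x, P x.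
Proof. by move=> h x; rewrite -[x]reprK; apply: h. Qed.

Lemma qrepr x : W (repr (qpi x) - x).
Proof. by apply/qpiP; rewrite /qpi reprK. Qed.

Definition qadd (x y : quot_mod) := qpi (repr x + repr y).
Definition qopp (x : quot_mod) := qpi (- repr x).
Definition qscale (c : K) (x : quot_mod) := qpi (c *: repr x).

Lemma qaddE x y : qadd (qpi x) (qpi y) = qpi (x + y).
Proof.
by apply/qpiP; rewrite opprD addrACA; apply: opnD => //; apply: qrepr.
Qed.
Lemma qoppE x : qopp (qpi x) = qpi (- x).
Proof. by apply/qpiP; rewrite -opprD; apply: opnN => //; apply: qrepr. Qed.
Lemma qscaleE c x : qscale c (qpi x) = qpi (c *: x).
Proof. by apply/qpiP; rewrite -scalerBr; apply: opnZ => //; apply: qrepr. Qed.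

Lemma qaddA : associative qadd.
Proof.
by elim/qpi_ind=> x; elim/qpi_ind=> y; elim/qpi_ind=> z; rewrite !qaddE addrA.
Qed.
Lemma qaddC : commutative qadd.
Proof. by elim/qpi_ind=> x; elim/qpi_ind=> y; rewrite !qaddE addrC. Qed.
Lemma qadd0 : left_id (qpi 0) qadd.
Proof. by elim/qpi_ind=> x; rewrite !qaddE add0r. Qed.
Lemma qaddN : left_inverse (qpi 0) qopp qadd.
Proof. by elim/qpi_ind=> x; rewrite qoppE qaddE addNr. Qed.
HB.instance Definition _ := GRing.isZmodule.Build quot_mod
  qaddA qaddC qadd0 qaddN.

Lemma qscaleA c d x : qscale c (qscale d x) = qscale (c * d) x.
Proof. by elim/qpi_ind: x => x; rewrite !qscaleE scalerA. Qed.
Lemma qscale1 : left_id 1 qscale.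
Proof. by elim/qpi_ind=> x; rewrite qscaleE scale1r. Qed.
Lemma qscaleDr : right_distributive qscale +%R.
Proof.
move=> c; elim/qpi_ind=> x; elim/qpi_ind=> y.
by rewrite [_ + _]qaddE !qscaleE [RHS]qaddE scalerDr.
Qed.
Lemma qscaleDl x : {morph qscale^~ x : c d / c + d >-> c + d}.
Proof.
by move=> c d; elim/qpi_ind: x => x; rewrite !qscaleE [RHS]qaddE scalerDl.
Qed.
HB.instance Definition _ := GRing.Zmodule_isLmodule.Build K quot_mod
  qscaleA qscale1 qscaleDr qscaleDl.

Lemma qpiD x y : qpi (x + y) = qpi x + qpi y. Proof. exact/esym/qaddE. Qed.
Lemma qpiZ c x : qpi (c *: x) = c *: qpi x. Proof. exact/esym/qscaleE. Qed.
Lemma qpi_sum I (r : seq I) (F : I -> C) :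
  qpi (\sum_(i <- r) F i) = \sum_(i <- r) qpi (F i).
Proof. exact: (big_morph qpi qpiD (erefl _)). Qed.
End Quotient.

Section TensorSum.
Variables (K : ctRingType) (A B C : ctAlgType K).
Implicit Types (f : A -> B -> C) (t : A \ox B).

Definition continuous_bilinear f : Prop :=
  bilinear_map f /\
  forall W, opn W -> exists U V, [/\ opn U, opn V,
    forall a b, U a -> W (f a b) & forall a b, V b -> W (f a b)].

Definition is_tlimit (F : set A -> set B -> C) (c : C) : Prop :=
  forall W, opn W -> exists U V, [/\ opn U, opn V &
    forall U' V', opn U' -> opn V' -> U' `<=` U -> V' `<=` V ->
      W (F U' V' - c)].

(* The value at t of the linear map A (x) B -> C extending f: the limit of     *)
(* the sums of f over the finite sums of pure tensors approximating t          *)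
(* ([tsumP] for existence, [tsum_pure] and [tensor_ext] for uniqueness).       *)
(* [\tsum_(a, b <~ t) f a b] renders the implicit summation                    *)
(* f(t_1, t_2) where t = t_1 (x) t_2.                                          *)
Definition tsum f t : C :=
  xget 0 [set c | is_tlimit
    (fun U V => \sum_(p <- component t U V) f p.1 p.2) c].

Lemma tcong_test f U V (s t : seq (A * B)) (W : set C) : bilinear_map f -> opn W ->
  (forall a b, U a -> W (f a b)) -> (forall a b, V b -> W (f a b)) ->
  tcong U V s t ->
  W (\sum_(p <- s) f p.1 p.2 - \sum_(p <- t) f p.1 p.2).
Proof.
move=> bf oW Uf Vf st; apply/(qpiP oW); rewrite !qpi_sum.
apply: (st _ (fun a b => qpi oW (f a b))).
- split=> [a c b b'|b c a a']; rewrite -qpiZ -qpiD.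
    by rewrite bilDr // bilZr.
  by rewrite bilDl // bilZl.
- by move=> a b Ua; apply/qpiP; rewrite subr0; apply: Uf.
- by move=> a b Vb; apply/qpiP; rewrite subr0; apply: Vf.
Qed.

Lemma is_tlimit_uniq F c c' : is_tlimit F c -> is_tlimit F c' -> c = c'.
Proof.
move=> h h'; apply/eqP; rewrite -subr_eq0; apply/eqP.
apply: (ideal_separated (@opnP K C)) => W oW.
have [U [V [oU oV hU]]] := h W oW; have [U' [V' [oU' oV' hU']]] := h' W oW.
have [U2 oU2 sU] := ideal_cap (@opnP K A) oU oU'.
have [V2 oV2 sV] := ideal_cap (@opnP K B) oV oV'.
have h1 := hU U2 V2 oU2 oV2 (fun x h => (sU x h).1) (fun x h => (sV x h).1).
have h2 := hU' U2 V2 oU2 oV2 (fun x h => (sU x h).2) (fun x h => (sV x h).2).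
rewrite -(subrKA (F U2 V2)).
by apply: opnD => //; rewrite -opprB; apply: opnN.
Qed.

Lemma tsumP f t : continuous_bilinear f ->
  is_tlimit (fun U V => \sum_(p <- component t U V) f p.1 p.2) (tsum f t).
Proof.
move=> [bf cf].
have /choice[N hN] : forall W : set C, exists UV : set A * set B,
    opn W -> [/\ opn UV.1, opn UV.2, forall a b, UV.1 a -> W (f a b)
      & forall a b, UV.2 b -> W (f a b)].
  move=> W; case: (pselect (opn W)) => [oW|nW].
    by have [U [V h]] := cf W oW; exists (U, V).
  by exists (set0, set0).
pose S U V := \sum_(p <- component t U V) f p.1 p.2.
have key W U V : opn W -> opn U -> opn V -> U `<=` (N W).1 ->
    V `<=` (N W).2 -> W (S U V - S (N W).1 (N W).2).
  move=> oW oU oV sU sV; have [oU0 oV0 fU fV] := hN W oW.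
  by apply: (tcong_test bf oW fU fV); apply: component_coherent.
have [c hc] : exists c, forall W, opn W -> W (c - S (N W).1 (N W).2).
  apply: (ideal_complete (@opnP K C) (x := fun W => S (N W).1 (N W).2)).
  move=> W W' oW oW' sW.
  have [oU oV _ _] := hN W oW; have [oU' oV' _ _] := hN W' oW'.
  have [U2 oU2 sU] := ideal_cap (@opnP K A) oU oU'.
  have [V2 oV2 sV] := ideal_cap (@opnP K B) oV oV'.
  have h1 := key W U2 V2 oW oU2 oV2 (fun x h => (sU x h).1) (fun x h => (sV x h).1).
  have h2 := key W' U2 V2 oW' oU2 oV2 (fun x h => (sU x h).2) (fun x h => (sV x h).2).
  rewrite -(subrKA (S U2 V2)); apply: opnD => //; last exact: sW.
  by rewrite -opprB; apply: opnN.
apply: (@xgetPex _ 0 [set c | is_tlimit S c]); exists c => W oW.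
have [oU oV _ _] := hN W oW; exists (N W).1, (N W).2; split=> // U V oU' oV' sU sV.
rewrite -(subrKA (S (N W).1 (N W).2)); apply: opnD => //; first exact: key.
by rewrite -opprB; apply: opnN => //; apply: hc.
Qed.

Lemma tsum_uniq f t c : continuous_bilinear f ->
  is_tlimit (fun U V => \sum_(p <- component t U V) f p.1 p.2) c ->
  tsum f t = c.
Proof. by move=> cf; apply: is_tlimit_uniq; apply: tsumP. Qed.

End TensorSum.

Reserved Notation "'\tsum_' ( a , b <~ t ) F"
  (at level 41, F at level 41, a name, b name, t at level 50,
   format "'[' '\tsum_' ( a ,  b  <~  t ) '/  '  F ']'").
Notation "'\tsum_' ( a , b <~ t ) F" := (tsum (fun a b => F) t) : ring_scope.

Definition continuous_linear (K : ctRingType) (A B : ctAlgType K)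
    (f : A -> B) : Prop :=
  linear f /\
  forall W, opn W -> exists2 U, opn U & forall x, U x -> W (f x).

Section TensorSumTheory.
Variables (K : ctRingType) (A B : ctAlgType K).

Lemma pure_bilinear : bilinear_map (@pure_tensor K A B).
Proof.
split=> [a c b b'|b c a a']; apply: ctensorP => U V P g oU oV ag;
  rewrite [RHS]tval_add // [in RHS]tval_scale // !tval_pure //;
  case: ag => bg _ _.
  by rewrite bilDr // bilZr.
by rewrite bilDl // bilZl.
Qed.

Lemma of_net_tcong (G : set A -> set B -> seq (A * B)) (cG : coherent G) U V :
  opn U -> opn V -> tcong U V (component (of_net cG) U V) (G U V).
Proof. by move=> oU oV P f bf Uf Vf; apply: of_netE. Qed.

Lemma is_tlimit_near (C : ctAlgType K) (F G : set A -> set B -> C) c :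
  is_tlimit F c ->
  (forall W, opn W -> exists U V, [/\ opn U, opn V &
    forall U' V', opn U' -> opn V' -> U' `<=` U -> V' `<=` V ->
      W (G U' V' - F U' V')]) -> is_tlimit G c.
Proof.
move=> hF hG W oW.
have [U [V [oU oV hU]]] := hF W oW; have [U' [V' [oU' oV' hU']]] := hG W oW.
have [U2 oU2 sU] := ideal_cap (@opnP K A) oU oU'.
have [V2 oV2 sV] := ideal_cap (@opnP K B) oV oV'.
exists U2, V2; split=> // U3 V3 oU3 oV3 sU3 sV3.
rewrite -(subrKA (F U3 V3)); apply: opnD => //.
  by apply: hU' => // x => [/sU3/sU[]|/sV3/sV[]].
by apply: hU => // x => [/sU3/sU[]|/sV3/sV[]].
Qed.

Section Fixed.
Variables (C : ctAlgType K) (f : A -> B -> C).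
Hypothesis cf : continuous_bilinear f.

Lemma tsum_tcong (t : A \ox B) (G : set A -> set B -> seq (A * B)) :
  (forall U V, opn U -> opn V -> tcong U V (component t U V) (G U V)) ->
  is_tlimit (fun U V => \sum_(p <- G U V) f p.1 p.2) (tsum f t).
Proof.
move=> tG; apply: is_tlimit_near (tsumP t cf) _ => W oW.
have [U [V [oU oV fU fV]]] := cf.2 W oW; exists U, V; split=> //.
move=> U' V' oU' oV' sU sV; apply: (tcong_test cf.1 oW fU fV).
by apply/tcong_sym/(tcong_sub sU sV)/tG.
Qed.

Lemma tsum_pure a b : tsum f (a \ox b) = f a b.
Proof.
have h := @tsum_tcong (a \ox b) (fun _ _ => [:: (a, b)]) (of_net_tcong _).
apply: (is_tlimit_uniq h) => W oW.
have [U [V [oU oV _ _]]] := cf.2 W oW; exists U, V; split=> // *.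
by rewrite big_seq1 subrr; apply: opn0.
Qed.

Lemma tsum_linear : linear (tsum f).
Proof.
move=> c x y.
have h := @tsum_tcong (c *: x + y)
  (fun U V => sscale c (component x U V) ++ component y U V).
apply: (is_tlimit_uniq (h _)) => [U V oU oV|W oW].
  apply: tcong_trans (of_net_tcong _ oU oV) _.
  by apply: tcong_cat => //; apply: of_net_tcong.
have [U [V [oU oV hx]]] := tsumP x cf oW.
have [U' [V' [oU' oV' hy]]] := tsumP y cf oW.
have [U2 oU2 sU] := ideal_cap (@opnP K A) oU oU'.
have [V2 oV2 sV] := ideal_cap (@opnP K B) oV oV'.
exists U2, V2; split=> // U3 V3 oU3 oV3 sU3 sV3.
rewrite big_cat (sum_sscale cf.1) opprD addrACA -scalerBr.
apply: opnD => //.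
  by apply: opnZ => //; apply: hx => // z => [/sU3/sU[]|/sV3/sV[]].
by apply: hy => // z => [/sU3/sU[]|/sV3/sV[]].
Qed.

Lemma tsum_continuous : continuous_linear (tsum f).
Proof.
split=> [|W oW]; first exact: tsum_linear.
have [U [V [oU oV fU fV]]] := cf.2 W oW.
exists (tnbhs U V); first by exists U, V.
move=> t tUV; have [U' [V' [oU' oV' h]]] := tsumP t cf oW.
have [U2 oU2 sU] := ideal_cap (@opnP K A) oU oU'.
have [V2 oV2 sV] := ideal_cap (@opnP K B) oV oV'.
have h1 := h U2 V2 oU2 oV2 (fun x h => (sU x h).2) (fun x h => (sV x h).2).
have h2 : W (\sum_(p <- component t U2 V2) f p.1 p.2 -
             \sum_(p <- [::]) f p.1 p.2).
  apply: (tcong_test cf.1 oW fU fV); apply: tcong_trans tUV.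
  by apply: component_coherent => // x => [/sU[]|/sV[]].
rewrite big_nil subr0 in h2.
move: h1 h2; set S := \sum_(p <- _) _ => h1 h2.
rewrite (_ : tsum f t = S - (S - tsum f t)); last by rewrite opprB addrC subrK.
exact: opnB.
Qed.
End Fixed.

Lemma tensor_approx (t : A \ox B) W : opn W ->
  exists s : seq (A * B), W (t - \sum_(p <- s) p.1 \ox p.2).
Proof.
move=> [U [V [oU oV ->]]]; exists (component t U V).
apply/tnbhsP => P g ag; rewrite [LHS]tval_add // [X in _ + X]tval_opp //.
apply/eqP; rewrite subr_eq0; apply/eqP.
rewrite (big_morph (tval U V g) (fun x y => tval_add oU oV ag x y)
  (tval_zero oU oV ag)).
by apply: eq_bigr => p _; rewrite tval_pure.
Qed.

Lemma tensor_ext (C : ctAlgType K) (L L' : A \ox B -> C) :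
  continuous_linear L -> continuous_linear L' ->
  (forall a b, L (a \ox b) = L' (a \ox b)) -> L =1 L'.
Proof.
move=> [lL cL] [lL' cL'] e t; apply/eqP; rewrite -subr_eq0; apply/eqP.
apply: (ideal_separated (@opnP K C)) => W oW.
have [U oU UL] := cL W oW; have [U' oU' UL'] := cL' W oW.
have [U2 oU2 sU] := ideal_cap (@opnP K (A \ox B)%type) oU oU'.
have [s hs] := tensor_approx t oU2.
set u := \sum_(p <- s) _ in hs.
have eu : L u = L' u.
  have L0 : L 0 = 0 
    by rewrite -[X in L X](subrr 0) (zmod_morphism_linear lL) subrr.
  have L'0 : L' 0 = 0 
    by rewrite -[X in L' X](subrr 0) (zmod_morphism_linear lL') subrr.
  have LD : {morph L : x y / x + y} by move=> x y; have := lL 1 x y; rewrite !scale1r.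
  have L'D : {morph L' : x y / x + y} by move=> x y; have := lL' 1 x y; rewrite !scale1r.
  rewrite /u (big_morph L LD L0) (big_morph L' L'D L'0).
  by apply: eq_bigr => p _; apply: e.
have e1 : L (t - u) = L t - L u by exact: (zmod_morphism_linear lL).
have e2 : L' (t - u) = L' t - L' u by exact: (zmod_morphism_linear lL').
have h1 := UL _ (sU _ hs).1; have h2 := UL' _ (sU _ hs).2.
rewrite e1 in h1; rewrite e2 -eu in h2.
rewrite -(subrKA (L u)); apply: opnD => //.
by rewrite -opprB; apply: opnN.
Qed.

Lemma continuous_linear_comp (C D : ctAlgType K) (g : C -> D) (f : B -> C) :
  continuous_linear g -> continuous_linear f ->
  continuous_linear (fun x => g (f x)).
Proof.
move=> [lg cg] [lf cf]; split=> [c x y|W oW]; first by rewrite lf lg.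
have [V oV hV] := cg W oW; have [U oU hU] := cf V oV.
by exists U => // x /hU/hV.
Qed.

Lemma continuous_linear_lmul (x : B) : continuous_linear (fun y => x * y).
Proof.
split=> [c y z|W oW]; first by rewrite mulrDr ctscalerAr.
by exists W => // y; apply: opnMl.
Qed.

Lemma continuous_linear_rmul (x : B) : continuous_linear (fun y => y * x).
Proof.
split=> [c y z|W oW]; first by rewrite mulrDl ctscalerAl.
by exists W => // y; apply: opnMr.
Qed.

Lemma continuous_linear_sum (C : ctAlgType K) I (r : seq I)
    (f : I -> B -> C) : (forall i, continuous_linear (f i)) ->
  continuous_linear (fun x => \sum_(i <- r) f i x).
Proof.
move=> hf; split=> [c x y|W oW].
  by rewrite scaler_sumr -big_split; apply: eq_bigr => i _; rewrite (hf i).1.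
elim: r => [|i r [U oU hU]].
  have [U oU] := ideal_ex (@opnP K B).
  by exists U => // x _; rewrite big_nil; apply: opn0.
have [U' oU' hU'] := (hf i).2 W oW.
have [V oV sV] := ideal_cap (@opnP K B) oU oU'.
exists V => // x /sV[/hU h /hU' h']; rewrite big_cons.
exact: opnD.
Qed.

End TensorSumTheory.

Definition algebra_morphism (K : ctRingType) (A B : ctAlgType K)
    (f : A -> B) : Prop :=
  [/\ continuous_linear f, {morph f : x y / x * y} & f 1 = 1].

Record hopfAlgType (K : ctRingType) := HopfAlg {
  hopf_sort :> ctAlgType K;
  coproduct : hopf_sort -> (hopf_sort \ox hopf_sort)%type;
  counit : hopf_sort -> K^o;
  antipode : hopf_sort -> hopf_sort;
  coproduct_morphism : algebra_morphism coproduct;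
  counit_morphism : algebra_morphism counit;
  antipode_continuous : continuous_linear antipode;
  coassociative : forall x : hopf_sort,
    \tsum_(a, b <~ coproduct x) \tsum_(a1, a2 <~ coproduct a)
      (a1 \ox (a2 \ox b)) = \tsum_(a, b <~ coproduct x) (a \ox coproduct b);
  counitl : forall x : hopf_sort, \tsum_(a, b <~ coproduct x) (counit a *: b) = x;
  counitr : forall x : hopf_sort, \tsum_(a, b <~ coproduct x) (counit b *: a) = x;
  antipodel : forall x : hopf_sort,
    \tsum_(a, b <~ coproduct x) (antipode a * b) = counit x *: (1 : hopf_sort);
  antipoder : forall x : hopf_sort,
    \tsum_(a, b <~ coproduct x) (a * antipode b) = counit x *: (1 : hopf_sort) }.

Arguments coproduct {K h} _.
Arguments counit {K h} _.
Arguments antipode {K h} _.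

Section QuasiTriangular.
Variables (K : ctRingType) (H : hopfAlgType K).

Definition tflip (t : H \ox H) : H \ox H := \tsum_(a, b <~ t) (b \ox a).

Definition leg12 (t : H \ox H) : H \ox (H \ox H) :=
  \tsum_(a, b <~ t) (a \ox (b \ox 1)).
Definition leg13 (t : H \ox H) : H \ox (H \ox H) :=
  \tsum_(a, b <~ t) (a \ox (1 \ox b)).
Definition leg23 (t : H \ox H) : H \ox (H \ox H) := 1 \ox t.

Definition coproduct_id (t : H \ox H) : H \ox (H \ox H) :=
  \tsum_(a, b <~ t) \tsum_(a1, a2 <~ coproduct a) (a1 \ox (a2 \ox b)).
Definition id_coproduct (t : H \ox H) : H \ox (H \ox H) :=
  \tsum_(a, b <~ t) (a \ox coproduct b).

Record quasitriangular (R : H \ox H) : Prop := Quasitriangular {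
  quasi_unit : exists R', R * R' = 1 /\ R' * R = 1;
  quasi_coproduct_id : coproduct_id R = leg13 R * leg23 R;
  quasi_id_coproduct : id_coproduct R = leg13 R * leg12 R;
  quasi_coproduct : forall x : H, R * coproduct x = tflip (coproduct x) * R }.

Definition adjoint_action (x y : H) : H :=
  \tsum_(x1, x2 <~ coproduct x) (x1 * y * antipode x2).

End QuasiTriangular.

Section Dual.
Variables (K : ctRingType) (H : hopfAlgType K).

(* Finite dimensional representations: free of finite rank over K, continuous. *)
Record representation n (rho : H -> 'M[K]_n) : Prop := Representation {
  rep_linear : linear rho;
  rep1 : rho 1 = 1%:M;
  repM : forall x y, rho (x * y) = rho x *m rho y;
  rep_continuous : forall I, @ring_opn K I ->
    exists2 U, opn U & forall x, U x -> forall i j, I (rho x i j) }.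

(* H^* is the K-span of the matrix coefficients, inside the functions H -> K;  *)
(* its pairing with H is evaluation.                                           *)
Inductive in_dual : (H -> K^o) -> Prop :=
| DualCoeff n (rho : H -> 'M[K]_n) i j :
    representation rho -> in_dual (fun x => rho x i j)
| Dual0 : in_dual 0
| DualD a b : in_dual a -> in_dual b -> in_dual (a + b)
| DualZ (c : K) a : in_dual a -> in_dual (c *: a).

Definition dual_pred : {pred H -> K^o} := fun a => `[< in_dual a >].

Record dual := Dual { dual_fun :> H -> K^o; dualP : dual_fun \in dual_pred }.

HB.instance Definition _ := [isSub for dual_fun].
HB.instance Definition _ := [Choice of dual by <:].

Lemma dual_closed : subsemimod_closed dual_pred.
Proof.
split; first split; first by apply/asboolP; apply: Dual0.
- by move=> a b /asboolP da /asboolP db; apply/asboolP; apply: DualD.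
- by move=> c a /asboolP da; apply/asboolP; apply: DualZ.
Qed.

HB.instance Definition _ :=
  GRing.SubChoice_isSubLmodule.Build K (H -> K^o) dual_pred dual dual_closed.

Definition mk_dual a (da : in_dual a) : dual := Dual (asboolT da).

Lemma dual_in (a : dual) : in_dual a.
Proof. by apply/asboolP/dualP. Qed.

Lemma dual_ext (a b : dual) : a =1 b -> a = b.
Proof. by move=> e; apply: val_inj; apply/funext. Qed.

Lemma in_dual_sum I (r : seq I) (c : I -> K) (f : I -> H -> K^o) :
  (forall i, in_dual (f i)) ->
  in_dual (fun x => \sum_(i <- r) c i * f i x).
Proof.
move=> df; elim: r => [|i r IH].
  have -> : (fun x => \sum_(i <- [::]) c i * f i x) = 0 :> (H -> K^o).
    by apply/funext => x; rewrite big_nil.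
  exact: Dual0.
have -> : (fun x => \sum_(i <- i :: r) c i * f i x) =
    c i *: f i + (fun x => \sum_(i <- r) c i * f i x) :> (H -> K^o).
  by apply/funext => x; rewrite big_cons.
by apply: DualD => //; apply: DualZ.
Qed.

Lemma dual_continuous (a : H -> K^o) : in_dual a -> continuous_linear a.
Proof.
elim=> {a} [n rho i j [lr _ _ cr]||a b _ [la ca] _ [lb cb]|c a _ [la ca]].
- split=> [c x y|W oW]; first by rewrite lr !mxE.
  by have [U oU hU] := cr W oW; exists U => // x /hU.
- split=> [c x y|W oW]; first by rewrite /= scaler0 addr0.
  have [U oU] := ideal_ex (@opnP K H).
  by exists U => // x _; apply: (@opn0 K K^o).
- split=> [c x y|W oW].
    by rewrite !fctE la lb scalerDr addrACA.
  have [U oU hU] := ca W oW; have [V oV hV] := cb W oW.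
  have [U2 oU2 sU] := ideal_cap (@opnP K H) oU oV.
  by exists U2 => // x /sU[/hU ? /hV ?]; apply: (@opnD K K^o).
- split=> [d x y|W oW].
    by rewrite !fctE la scalerDr !scalerA mulrC.
  have [U oU hU] := ca W oW; exists U => // x /hU ?.
  exact: (@opnZ K K^o).
Qed.

Lemma mul_bilinear (A B : ctAlgType K) (f : A -> K^o) (g : B -> K^o) :
  continuous_linear f -> continuous_linear g ->
  continuous_bilinear (fun a b => f a * g b : K^o).
Proof.
move=> [lf cf] [lg cg]; split.
  split=> [a c b b'|b c a a'].
    by rewrite lg mulrDr ctscalerAr.
  by rewrite lf mulrDl ctscalerAl.
move=> W oW; have [U oU hU] := cf W oW; have [V oV hV] := cg W oW.
exists U, V; split=> // a b h.
  by apply: (@opnMr K K^o) => //; apply: hU.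
by apply: (@opnMl K K^o) => //; apply: hV.
Qed.

Lemma bilinear_sum (A B : ctAlgType K) I (r : seq I) (f : I -> A -> B -> K^o) :
  (forall i, continuous_bilinear (f i)) ->
  continuous_bilinear (fun a b => \sum_(i <- r) f i a b : K^o).
Proof.
move=> hf; split.
  split=> [a c b b'|b c a a']; rewrite scaler_sumr -big_split;
    apply: eq_bigr => i _ /=.
    by rewrite (bilDr (hf i).1) (bilZr (hf i).1).
  by rewrite (bilDl (hf i).1) (bilZl (hf i).1).
move=> W oW; elim: r => [|i r [U [V [oU oV hU hV]]]].
  have [U oU] := ideal_ex (@opnP K A); have [V oV] := ideal_ex (@opnP K B).
  by exists U, V; split=> // a b _; rewrite big_nil; apply: (@opn0 K K^o).
have [U' [V' [oU' oV' hU' hV']]] := (hf i).2 W oW.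
have [U2 oU2 sU] := ideal_cap (@opnP K A) oU oU'.
have [V2 oV2 sV] := ideal_cap (@opnP K B) oV oV'.
exists U2, V2; split=> // a b h; rewrite big_cons; apply: (@opnD K K^o) => //.
- by apply: hU'; case: (sU _ h).
- by apply: hU; case: (sU _ h).
- by apply: hV'; case: (sV _ h).
- by apply: hV; case: (sV _ h).
Qed.

Lemma bilinear_scale (A B : ctAlgType K) (c : K) (f : A -> B -> K^o) :
  continuous_bilinear f -> continuous_bilinear (fun a b => c *: f a b : K^o).
Proof.
move=> [bf cf]; split.
  split=> [a d b b'|b d a a'].
    by rewrite (bilDr bf) (bilZr bf) scalerDr !scalerA mulrC.
  by rewrite (bilDl bf) (bilZl bf) scalerDr !scalerA mulrC.
move=> W oW; have [U [V [oU oV hU hV]]] := cf W oW.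
exists U, V; split=> // a b h.
  by apply: (@opnZ K K^o) => //; apply: hU.
by apply: (@opnZ K K^o) => //; apply: hV.
Qed.

Lemma tsum_sum (A B : ctAlgType K) I (r : seq I) (c : I -> K)
    (f : I -> A -> B -> K^o) (t : A \ox B) :
  (forall i, continuous_bilinear (f i)) ->
  \tsum_(a, b <~ t) (\sum_(i <- r) c i *: f i a b) =
  \sum_(i <- r) c i *: \tsum_(a, b <~ t) f i a b.
Proof.
move=> hf.
have cb : continuous_bilinear (fun a b => \sum_(i <- r) c i *: f i a b : K^o).
  by apply: bilinear_sum => i; apply: bilinear_scale.
apply: (tensor_ext (tsum_continuous cb) (L' := fun t => _) _ _ t) => [|a b].
  apply: continuous_linear_sum => i.
  have [lt ct] := tsum_continuous (hf i); split=> [d x y|W oW].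
    by rewrite lt scalerDr !scalerA mulrC.
  have [U oU hU] := ct W oW.
  by exists U => // x /hU ?; apply: (@opnZ K K^o).
by rewrite tsum_pure //; apply: eq_bigr => i _; rewrite tsum_pure.
Qed.

Lemma tsum_mul (A B : ctAlgType K) I (r : seq I) (f : A -> B -> K^o)
    (g h : I -> A -> B -> K^o) (t u : A \ox B) :
  continuous_bilinear f -> (forall i, continuous_bilinear (g i)) ->
  (forall i, continuous_bilinear (h i)) ->
  (forall a b a' b', f (a * a') (b * b') = \sum_(i <- r) g i a b * h i a' b') ->
  tsum f (t * u) = \sum_(i <- r) tsum (g i) t * tsum (h i) u.
Proof.
move=> cf cg ch e.
apply: (tensor_ext (L := fun t => tsum f (t * u))
  (L' := fun t => \sum_(i <- r) tsum (g i) t * tsum (h i) u) _ _ _ t).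
- exact: continuous_linear_comp (tsum_continuous cf)
    (continuous_linear_rmul u).
- apply: continuous_linear_sum => i.
  exact: continuous_linear_comp (continuous_linear_rmul _)
    (tsum_continuous (cg i)).
move=> a b.
apply: (tensor_ext (L := fun u => tsum f (a \ox b * u))
  (L' := fun u => \sum_(i <- r) tsum (g i) (a \ox b) * tsum (h i) u) _ _ _ u).
- exact: continuous_linear_comp (tsum_continuous cf)
    (continuous_linear_lmul _).
- apply: continuous_linear_sum => i.
  exact: continuous_linear_comp (continuous_linear_lmul _)
    (tsum_continuous (ch i)).
move=> a' b'.
have -> : (a \ox b) * (a' \ox b') = (a * a') \ox (b * b').
  apply: ctensorP => U V P k oU oV ak.
  rewrite [LHS]tval_mul // !tval_pure //.
    exact: admissible_mul_r.
  exact: admissible_sum (fun q => admissible_mul_l oU oV ak q.1 q.2).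
rewrite tsum_pure // e; apply: eq_bigr => i _.
by rewrite !tsum_pure.
Qed.

Definition convolution (a b : H -> K^o) : H -> K^o :=
  fun y => \tsum_(y1, y2 <~ coproduct y) (a y1 * b y2 : K^o).

Lemma tensor_representation n m (rho : H -> 'M[K]_n) (sigma : H -> 'M[K]_m)
    i j k l : representation rho -> representation sigma ->
  in_dual (convolution (fun x => rho x i j) (fun x => sigma x k l)).
Proof.
move=> hr hs; pose T := ('I_n * 'I_m)%type.
have cr p q : continuous_linear (fun x => rho x p q : K^o).
  exact/dual_continuous/DualCoeff.
have cs p q : continuous_linear (fun x => sigma x p q : K^o).
  exact/dual_continuous/DualCoeff.
have cb (p q : T) : continuous_bilinear
    (fun a b => rho a p.1 q.1 * sigma b p.2 q.2 : K^o).
  exact: mul_bilinear.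
have [[lc cc] cM c1] := @coproduct_morphism K H.
pose tau (y : H) : 'M[K]_#|{: T}| := \matrix_(p, q)
  convolution (fun x => rho x (enum_val p).1 (enum_val q).1)
    (fun x => sigma x (enum_val p).2 (enum_val q).2) y.
have htau : representation tau.
  split.
  - move=> c x y; apply/matrixP => p q; rewrite !mxE /convolution lc.
    by rewrite (tsum_linear (cb _ _)).
  - apply/matrixP => p q; rewrite !mxE /convolution c1.
    rewrite [1](_ : _ = (1 : H) \ox (1 : H)); last first.
      by apply: ctensorP => *; rewrite tval_one // tval_pure.
    rewrite tsum_pure; last exact: cb.
    rewrite (rep1 hr) (rep1 hs) !mxE -natrM mulnb.
    by rewrite -xpair_eqE -!surjective_pairing (inj_eq enum_val_inj).
  - move=> x y; apply/matrixP => p q; rewrite !mxE /convolution cM.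
    rewrite (tsum_mul (r := enum {: T}) _ _ (cb (enum_val p) (enum_val q))
      (g := fun s a b => rho a (enum_val p).1 s.1 * sigma b (enum_val p).2 s.2)
      (h := fun s a b => rho a s.1 (enum_val q).1 * sigma b s.2 (enum_val q).2)).
    + rewrite big_enum /= (reindex_omap enum_val (fun x => Some (enum_rank x))) /=.
        by apply: eq_big => [s|s _]; rewrite ?enum_valK ?eqxx // !mxE.
      by move=> s _; rewrite enum_rankK.
    + by move=> s; apply: (cb _ s).
    + by move=> s; apply: (cb s).
    + move=> a b a' b'; rewrite (repM hr) (repM hs) !mxE big_distrlr /=.
      rewrite pair_big big_enum /=; apply: eq_bigr => s _ /=.
      by rewrite mulrACA.
  - move=> I oI.
    have key p q : exists2 U, @opn K H U & forall x, U x -> I (tau x p q).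
      have [V oV hV] := (tsum_continuous (cb (enum_val p) (enum_val q))).2 I oI.
      have [U oU hU] := cc V oV; exists U => // x /hU/hV.
      by rewrite mxE.
    have fin (S : finType) (Q : S -> H -> Prop) :
        (forall s, exists2 U, @opn K H U & forall x, U x -> Q s x) ->
        exists2 U, @opn K H U & forall x, U x -> forall s, Q s x.
      move=> hQ; suff [U oU hU] : exists2 U, @opn K H U &
          forall x, U x -> forall s, s \in enum S -> Q s x.
        by exists U => // x Ux s; apply: hU => //; rewrite mem_enum.
      elim: (enum S) => [|s r [U oU hU]].
        by have [U oU] := ideal_ex (@opnP K H); exists U.
      have [V oV hV] := hQ s.
      have [U2 oU2 sU] := ideal_cap (@opnP K H) oU oV.
      exists U2 => // x /sU[Ux Vx] s'; rewrite inE => /predU1P[->|].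
        exact: hV.
      exact: hU.
    have [U oU hU] := fin _ (fun p x => forall q, I (tau x p q))
      (fun p => fin _ (fun q x => I (tau x p q)) (key p)).
    by exists U.
have -> : convolution (fun x => rho x i j) (fun x => sigma x k l) =
    fun y => tau y (enum_rank (i, k)) (enum_rank (j, l)).
  by apply/funext => y; rewrite mxE !enum_rankK.
exact: DualCoeff.
Qed.

Definition coeff := {f : H -> K^o | exists n (rho : H -> 'M[K]_n) i j,
  representation rho /\ f = fun x => rho x i j}.

Lemma coeff_dual (f : coeff) : in_dual (sval f).
Proof. by case: f => f /= [n [rho [i [j [hr ->]]]]]; apply: DualCoeff. Qed.

Lemma coeff_convolution (f g : coeff) :
  in_dual (convolution (sval f) (sval g)).
Proof.
case: f g => f hf [g hg] /=; move: hf hg.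
move=> [n [rho [i [j [hr ->]]]]] [m [sigma [k [l [hs ->]]]]].
exact: tensor_representation.
Qed.

Lemma dual_coeffs a : in_dual a -> exists r : seq (K * coeff),
  forall x, a x = \sum_(p <- r) p.1 *: sval p.2 x.
Proof.
elim=> {a} [n rho i j hr||a b _ [r hr] _ [s hs]|c a _ [r hr]].
- exists [:: (1, exist _ _ (ex_intro _ n (ex_intro _ rho (ex_intro _ i
    (ex_intro _ j (conj hr erefl))))))] => x.
  by rewrite big_seq1 scale1r.
- by exists [::] => x; rewrite big_nil.
- by exists (r ++ s) => x; rewrite big_cat -hr -hs.
- exists [seq (c * p.1, p.2) | p <- r] => x.
  rewrite big_map fctE hr scaler_sumr; apply: eq_bigr => p _.
  by rewrite scalerA.
Qed.

Lemma convolution_dual a b : in_dual a -> in_dual b ->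
  in_dual (convolution a b).
Proof.
move=> /dual_coeffs[r hr] /dual_coeffs[s hs].
pose F (pq : (K * coeff) * (K * coeff)) := convolution (sval pq.1.2) (sval pq.2.2).
rewrite (_ : convolution a b = fun y =>
    \sum_(pq <- [seq (p, q) | p <- r, q <- s]) (pq.1.1 * pq.2.1) * F pq y).
  by apply: in_dual_sum => pq; apply: coeff_convolution.
apply/funext => y; rewrite /F /convolution -tsum_sum => [|pq].
  congr tsum; apply/funext => u; apply/funext => v.
  rewrite hr hs big_distrlr big_allpairs_dep /=.
  apply: eq_bigr => p _; apply: eq_bigr => q _.
  by rewrite -ctscalerAl -ctscalerAr scalerA.
by apply: mul_bilinear; apply/dual_continuous/coeff_dual.
Qed.

Lemma counit_dual : in_dual counit.
Proof.
have [[le ce] eM e1] := @counit_morphism K H.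
rewrite (_ : counit = fun x => ((counit x : K)%:M : 'M[K]_1) 0 0); last first.
  by apply/funext => x; rewrite mxE mulr1n.
apply: (@DualCoeff 1 (fun x => (counit x : K)%:M)); split.
- by move=> c x y; rewrite le raddfD /= -scale_scalar_mx.
- by rewrite e1.
- by move=> x y; rewrite eM scalar_mxM.
- move=> I oI; have [U oU hU] := ce I oI; exists U => // x /hU h i j.
  by rewrite mxE !ord1 eqxx mulr1n.
Qed.

Lemma left_translate_dual x a : in_dual a -> in_dual (fun y => a (y * x)).
Proof.
elim=> {a} [n rho i j hr||a b _ ha _ hb|c a _ ha].
- rewrite (_ : (fun y => _) = fun y => \sum_(k <- enum 'I_n) rho x k j * rho y i k).
    by apply: in_dual_sum => k; apply: DualCoeff.
  apply/funext => y; rewrite (repM hr) mxE big_enum; apply: eq_bigr => k _.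
  by rewrite mulrC.
- exact: Dual0.
- exact: (DualD ha hb).
- exact: (DualZ c ha).
Qed.

Lemma right_translate_dual x a : in_dual a -> in_dual (fun y => a (x * y)).
Proof.
elim=> {a} [n rho i j hr||a b _ ha _ hb|c a _ ha].
- rewrite (_ : (fun y => _) = fun y => \sum_(k <- enum 'I_n) rho x i k * rho y k j).
    by apply: in_dual_sum => k; apply: DualCoeff.
  by apply/funext => y; rewrite (repM hr) mxE big_enum.
- exact: Dual0.
- exact: (DualD ha hb).
- exact: (DualZ c ha).
Qed.

(* The structure of H^* transposed from H:                                     *)
(* <a b, y> = <a, y_(1)> <b, y_(2)>, and since <a_(1), x> <a_(2), y> = <a, xy>,*)
(* x |> a = a_(1) <a_(2), x> is y |-> <a, y x> while a <| x = <a_(1), x> a_(2) *)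
(* is y |-> <a, x y>.                                                          *)
Definition dual_mul (a b : dual) : dual :=
  mk_dual (convolution_dual (dual_in a) (dual_in b)).
Definition dual_one : dual := mk_dual counit_dual.
Definition left_act (x : H) (a : dual) : dual :=
  mk_dual (left_translate_dual x (dual_in a)).
Definition right_act (a : dual) (x : H) : dual :=
  mk_dual (right_translate_dual x (dual_in a)).

Local Notation "x |> a" := (left_act x a) (at level 40, left associativity).
Local Notation "a <| x" := (right_act a x) (at level 40, left associativity).

Lemma dual_split a : in_dual a -> exists r : seq (dual * dual * dual),
  forall x y z, a (x * y * z) = \sum_(p <- r) p.1.1 x * p.1.2 y * p.2 z.
Proof.
elim=> {a} [n rho i j hr||a b _ [r hr] _ [s hs]|c a _ [r hr]].
- pose e k l : dual := mk_dual (DualCoeff k l hr).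
  exists [seq (e i kl.1, e kl.1 kl.2, e kl.2 j) | kl <- enum {: 'I_n * 'I_n}].
  move=> x y z; rewrite big_map big_enum /= !(repM hr) mxE.
  transitivity (\sum_k \sum_l rho x i l * rho y l k * rho z k j).
    by apply: eq_bigr => k _; rewrite mxE mulr_suml.
  by rewrite exchange_big pair_big.
- by exists [::] => x y z; rewrite big_nil.
- by exists (r ++ s) => x y z; rewrite big_cat -hr -hs.
- exists [seq (c *: p.1.1, p.1.2, p.2) | p <- r] => x y z.
  rewrite big_map fctE hr scaler_sumr; apply: eq_bigr => p _ /=.
  by rewrite [RHS](_ : _ = c * p.1.1 x * p.1.2 y * p.2 z) // -!mulrA.
Qed.

Let arith1 (a b c d e f : K) :
  a * b * c * (d * e * f) = a * c * (d * e) * (b * f).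
Proof.
rewrite -!mulrA; congr (a * _); rewrite mulrCA; congr (c * _).
by rewrite mulrCA; congr (d * _); rewrite mulrCA.
Qed.
Let arith2 (a c d e g : K) : a * c * (d * e) * g = c * d * g * (a * e).
Proof. by rewrite [RHS]mulrAC [in RHS]mulrACA [c * a]mulrC. Qed.
Let arith3 (c d e g : K) : c * d * e * g = g * e * (c * d).
Proof. by rewrite [RHS]mulrC -mulrA [g * e]mulrC. Qed.
Let arith4 (c d e : K) : c * d * e = c * e * d.
Proof. by rewrite mulrAC. Qed.
Let arith5 (c d e : K) : c * d * e = d * (c * e).
Proof. by rewrite [RHS]mulrCA mulrA. Qed.

(* The multiplication m~ of the reflection equation dual, whose underlying     *)
(* module is H^*; it is evaluated at y so that the infinite sums are taken     *)
(* in K. Its unit is that of H^*, the counit.                                  *)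
Definition redual_mul_fun (R : H \ox H) (a b : dual) : H -> K^o := fun y =>
  \tsum_(r1, r2 <~ R) \tsum_(s1, s2 <~ R)
    dual_mul (r1 |> a <| s1) (b <| antipode r2 <| s2) y.

Lemma redual_mul_dual R a b : in_dual (redual_mul_fun R a b).
Proof.
have [r hr] := dual_split (dual_in a); have [s hs] := dual_split (dual_in b).
have cd (f : dual) := dual_continuous (dual_in f).
have cda (f : dual) := continuous_linear_comp (cd f) (@antipode_continuous K H).
pose I := ((dual * dual * dual) * (dual * dual * dual))%type.
pose rs : seq I := [seq (p, q) | p <- r, q <- s].
pose c (pq : I) : K := \tsum_(r1, r2 <~ R) (pq.1.2 r1 * pq.2.1.1 (antipode r2) : K^o).
pose d (pq : I) : K := \tsum_(s1, s2 <~ R) (pq.1.1.1 s1 * pq.2.1.2 s2 : K^o).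
rewrite (_ : redual_mul_fun R a b = fun y => \sum_(pq <- rs)
    (d pq * c pq) * convolution pq.1.1.2 pq.2.2 y).
  by apply: in_dual_sum => pq; apply: convolution_dual; apply: dual_in.
apply/funext => y.
pose e (pq : I) : K := convolution pq.1.1.2 pq.2.2 y.
have inner r1 r2 s1 s2 : dual_mul (r1 |> a <| s1) (b <| antipode r2 <| s2) y =
    \sum_(pq <- rs) (pq.1.2 r1 * pq.2.1.1 (antipode r2) * e pq) *:
       (pq.1.1.1 s1 * pq.2.1.2 s2 : K^o).
  transitivity (\sum_(pq <- rs) (pq.1.1.1 s1 * pq.1.2 r1 *
     (pq.2.1.1 (antipode r2) * pq.2.1.2 s2)) *: convolution pq.1.1.2 pq.2.2 y).
    rewrite -tsum_sum => [|pq]; last exact: mul_bilinear.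
    congr tsum; apply/funext => u; apply/funext => v /=.
    rewrite hr mulrA hs big_distrlr big_allpairs_dep /=.
    apply: eq_bigr => p _; apply: eq_bigr => q _.
    exact: arith1.
  by apply: eq_bigr => pq _; apply: arith2.
transitivity (\tsum_(r1, r2 <~ R) (\sum_(pq <- rs)
   (d pq * e pq) *: (pq.1.2 r1 * pq.2.1.1 (antipode r2) : K^o) : K^o)).
  congr tsum; apply/funext => r1; apply/funext => r2.
  transitivity (\tsum_(s1, s2 <~ R) (\sum_(pq <- rs) (pq.1.2 r1 * pq.2.1.1 (antipode r2) * e pq) *:
       (pq.1.1.1 s1 * pq.2.1.2 s2 : K^o) : K^o)).
    by congr tsum; apply/funext => s1; apply/funext => s2.
  rewrite tsum_sum => [|pq]; last exact: mul_bilinear.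
  by apply: eq_bigr => pq _; apply: arith3.
rewrite tsum_sum => [|pq]; last exact: (mul_bilinear (cd _) (cda _)).
by apply: eq_bigr => pq _; apply: arith4.
Qed.

Definition redual_mul (R : H \ox H) (a b : dual) : dual :=
  mk_dual (redual_mul_dual R a b).

Definition coadjoint_fun (x : H) (a : dual) : H -> K^o := fun y =>
  \tsum_(x1, x2 <~ coproduct x) (x2 |> a <| antipode x1) y.

Lemma coadjoint_dual x a : in_dual (coadjoint_fun x a).
Proof.
have [r hr] := dual_split (dual_in a).
have cd (f : dual) := dual_continuous (dual_in f).
have cda (f : dual) := continuous_linear_comp (cd f) (@antipode_continuous K H).
rewrite (_ : coadjoint_fun x a = fun y => \sum_(p <- r)
    (\tsum_(x1, x2 <~ coproduct x) (p.1.1 (antipode x1) * p.2 x2 : K^o))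
      * p.1.2 y).
  by apply: in_dual_sum => p; apply: dual_in.
apply/funext => y; rewrite /coadjoint_fun.
transitivity (\tsum_(x1, x2 <~ coproduct x) (\sum_(p <- r)
   (p.1.2 y : K) *: (p.1.1 (antipode x1) * p.2 x2 : K^o) : K^o)).
  congr tsum; apply/funext => u; apply/funext => v /=.
  by rewrite hr; apply: eq_bigr => p _; apply: arith5.
rewrite tsum_sum => [|p]; last exact: (mul_bilinear (cda _) (cd _)).
by apply: eq_bigr => p _; apply: mulrC.
Qed.

Definition coadjoint_action (x : H) (a : dual) : dual :=
  mk_dual (coadjoint_dual x a).

Definition q_element (R : H \ox H) : H \ox H := tflip R * R.

Definition q_map (R : H \ox H) (a : dual) : H :=
  \tsum_(q1, q2 <~ q_element R) (a q1 *: q2).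

End Dual.

(* Main.v *)
(** Write Q = R_{21} R.  The map is eta |-> (eta (x) id)(Q), and it intertwines the
    two actions because Q commutes with every Delta(x).  It sends the product of
    a and b to (a (x) b (x) id)(Y), where Y is X = R_{12} (Delta (x) id)(Q) with its
    first leg multiplied on the right by r_1 and its second leg on the left by
    gamma(r_2), for a further copy r of R.  The two hexagon identities and
    Q Delta(x) = Delta(x) Q give X = Q_{13} R_{12} Q_{23}; the factor r cancels
    R_{12}, so Y = Q_{13} Q_{23}. *)

Require Import Defs.
From HB Require Import structures.
From mathcomp Require Import all_boot all_order all_algebra.
From mathcomp Require Import boolp classical_sets functions.

Set Implicit Arguments.
Unset Strict Implicit.
Unset Printing Implicit Defensive.

Import GRing.Theory.
Local Open Scope ring_scope.

(** Elements of a completed tensor product are limits rather than finite sums, so Sweedler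
    computations cannot be carried out literally. The remedy is to put a free tensor variable in
    place of R, Q or Delta(x), to show both sides continuous and linear in it, and to compare them
    on pure tensors only. Leg notation is replaced by algebra morphisms f, g, h from H to an
    arbitrary algebra C with commuting images. A hexagon identity proved once in this form can be
    used with its legs permuted, and with the counit, viewed as a map to scalars of C, in the role
    of a leg. Functionals and the antipode are not algebra morphisms, so the statements in which
    they occur ask for continuity only. *)

Section ContinuousMaps.
Variables (K : ctRingType).
Implicit Types (A B C D : ctAlgType K).

(** * Continuity of linear and bilinear maps and of sums over a tensor *)

Lemma continuous_linear_id A : continuous_linear (@id A).
Proof. by split=> // W oW; exists W. Qed.

Lemma comp_continuous A B C (g : B -> C) (f : A -> B) :
  continuous_linear g -> continuous_linear f -> continuous_linear (g \o f).
Proof. by move=> cg cf; apply: (continuous_linear_comp cg cf). Qed.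

Lemma linear_continuousZ A B (f : A -> B) c x :
  continuous_linear f -> f (c *: x) = c *: f x.
Proof. by move=> [lf _]; have := scalable_linear lf c x. Qed.

Lemma scale_continuous A B (f : A -> K^o) (c : B) :
  continuous_linear f -> continuous_linear (fun x => f x *: c).
Proof.
move=> [lf cf]; split=> [k x y|W oW].
  by rewrite lf scalerDl scalerA.
have [I oI hI] := ctscale_continuous W oW; have [U oU hU] := cf I oI.
by exists U => // x /hU; apply: hI.
Qed.

Lemma lincomb_continuous A B (k : K) (f g : A -> B) :
  continuous_linear f -> continuous_linear g ->
  continuous_linear (fun x => k *: f x + g x).
Proof.
move=> [lf cf] [lg cg]; split=> [c x y|W oW].
  rewrite lf lg !scalerDr !scalerA [k * c]mulrC -!addrA; congr (_ + _).
  by rewrite addrCA.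
have [U oU hU] := cf W oW; have [V oV hV] := cg W oW.
have [U2 oU2 sU] := ideal_cap (@opnP K A) oU oV.
exists U2 => // x /sU[/hU h /hV h']; apply: opnD => //; exact: opnZ.
Qed.

Lemma mul_continuous_bilinear A B C (f : A -> C) (g : B -> C) :
  continuous_linear f -> continuous_linear g ->
  continuous_bilinear (fun a b => f a * g b).
Proof.
move=> [lf cf] [lg cg]; split.
  split=> [a c b b'|b c a a'].
    by rewrite lg mulrDr ctscalerAr.
  by rewrite lf mulrDl ctscalerAl.
move=> W oW; have [U oU hU] := cf W oW; have [V oV hV] := cg W oW.
exists U, V; split=> // a b h.
  by apply: opnMr => //; apply: hU.
by apply: opnMl => //; apply: hV.
Qed.

Lemma pure_continuous_bilinear A B : continuous_bilinear (@pure_tensor K A B).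
Proof.
split; first exact: pure_bilinear.
move=> _ [U [V [oU oV ->]]]; exists U, V; split=> // a b h;
  apply/tnbhsP => P g ag; rewrite tval_pure //; case: ag => _ Ug Vg.
  exact: Ug.
exact: Vg.
Qed.

Lemma comp_continuous_bilinear A B C D (L : C -> D) (f : A -> B -> C) :
  continuous_linear L -> continuous_bilinear f ->
  continuous_bilinear (fun a b => L (f a b)).
Proof.
move=> [lL cL] [bf cf]; split.
  split=> [a c b b'|b c a a'].
    by rewrite (bilDr bf) (bilZr bf) lL.
  by rewrite (bilDl bf) (bilZl bf) lL.
move=> W oW; have [X oX hX] := cL W oW.
have [U [V [oU oV hU hV]]] := cf X oX; exists U, V; split=> // a b h; apply: hX.
  exact: hU.
exact: hV.
Qed.

Lemma swap_continuous_bilinear A B C (f : A -> B -> C) :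
  continuous_bilinear f -> continuous_bilinear (fun b a => f a b).
Proof.
move=> [[l1 l2] cf]; split; first by split.
by move=> W oW; have [U [V [oU oV hU hV]]] := cf W oW; exists V, U; split=> // a b;
  [exact: hV|exact: hU].
Qed.

Lemma eq_tsum A B C (f g : A -> B -> C) t :
  (forall a b, f a b = g a b) -> tsum f t = tsum g t.
Proof. by move=> e; congr tsum; apply/funext => a; apply/funext => b. Qed.

Lemma linear_tsum A B C D (L : C -> D) (f : A -> B -> C) t :
  continuous_linear L -> continuous_bilinear f ->
  L (tsum f t) = \tsum_(a, b <~ t) L (f a b).
Proof.
move=> cL cf; have cLf := comp_continuous_bilinear cL cf.
apply: (tensor_ext (L := L \o tsum f) _ (tsum_continuous cLf) _ t).
  exact: comp_continuous cL (tsum_continuous cf).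
by move=> a b; rewrite /= !tsum_pure.
Qed.

(** In its uses the combined map has the same shape as its two summands, so its continuity comes
    from the fact that already gives theirs. *)
Lemma tsum_lincomb A B C (k : K) (f g : A -> B -> C) t :
  continuous_bilinear f -> continuous_bilinear g ->
  continuous_bilinear (fun a b => k *: f a b + g a b) ->
  \tsum_(a, b <~ t) (k *: f a b + g a b) = k *: tsum f t + tsum g t.
Proof.
move=> cf cg ch.
apply: (tensor_ext (L := tsum _) (L' := fun t => k *: tsum f t + tsum g t) _ _ _ t).
- exact: tsum_continuous.
- by apply: lincomb_continuous; apply: tsum_continuous.
by move=> a b; rewrite !tsum_pure.
Qed.

(** The limit differs from some finite sum by an element of [W], and [W] is closed under finite
    sums. *)
Lemma tsum_opn A B C (f : A -> B -> C) t W :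
  continuous_bilinear f -> opn W -> (forall a b, W (f a b)) -> W (tsum f t).
Proof.
move=> cf oW Wf; have [U [V [oU oV h]]] := tsumP t cf oW.
have := h U V oU oV (fun _ => id) (fun _ => id).
set s := \sum_(p <- _) _ => hs.
rewrite (_ : tsum f t = s - (s - tsum f t)); last by rewrite opprB addrC subrK.
by apply: opnB => //; apply: opn_sum.
Qed.

Lemma pureM A B (a a' : A) (b b' : B) :
  (a \ox b) * (a' \ox b') = (a * a') \ox (b * b').
Proof.
apply: ctensorP => U V P k oU oV ak.
rewrite [LHS]tval_mul // !tval_pure //.
  exact: admissible_mul_r.
exact: admissible_sum (fun q => admissible_mul_l oU oV ak q.1 q.2).
Qed.

Lemma pure1 A B : (1 : A) \ox (1 : B) = 1.
Proof. by apply: ctensorP => *; rewrite tval_pure // tval_one. Qed.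

End ContinuousMaps.

(** * Lifts of pairs of maps to the tensor product *)

Section Lift.
Variables (K : ctRingType).
Implicit Types (A B C D : ctAlgType K).

Lemma morphism_continuous A B (f : A -> B) :
  algebra_morphism f -> continuous_linear f.
Proof. by case. Qed.

Lemma algebra_morphism_id A : algebra_morphism (@id A).
Proof. by split=> //; apply: continuous_linear_id. Qed.

Lemma algebra_morphism_comp A B C (g : B -> C) (f : A -> B) :
  algebra_morphism g -> algebra_morphism f -> algebra_morphism (g \o f).
Proof.
move=> [cg gM g1] [cf fM f1]; split; first exact: comp_continuous.
  by move=> x y; rewrite /= fM gM.
by rewrite /= f1.
Qed.

Definition tensorl A B (a : A) : (A \ox B)%type := a \ox 1.
Definition tensorr A B (b : B) : (A \ox B)%type := 1 \ox b.

Lemma tensorl_morphism A B : algebra_morphism (@tensorl A B).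
Proof.
split; last exact: pure1; last by move=> x y; rewrite [RHS]pureM mulr1.
have [bp cp] := @pure_continuous_bilinear K A B; split.
  by move=> c x y; rewrite /tensorl (bilDl bp) (bilZl bp).
move=> W oW; have [U [V [oU oV hU hV]]] := cp W oW.
by exists U => // x; apply: hU.
Qed.

Lemma tensorr_morphism A B : algebra_morphism (@tensorr A B).
Proof.
split; last exact: pure1; last by move=> x y; rewrite [RHS]pureM mulr1.
have [bp cp] := @pure_continuous_bilinear K A B; split.
  by move=> c x y; rewrite /tensorr (bilDr bp) (bilZr bp).
move=> W oW; have [U [V [oU oV hU hV]]] := cp W oW.
by exists V => // x; apply: hV.
Qed.

Lemma tensorlr A B (a : A) (b : B) : tensorl B a * tensorr A b = a \ox b.
Proof. by rewrite [LHS]pureM mulr1 mul1r. Qed.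

Definition commuting A B C (f : A -> C) (g : B -> C) :=
  forall a b, f a * g b = g b * f a.

Lemma commutingC A B C (f : A -> C) (g : B -> C) :
  commuting f g -> commuting g f.
Proof. by move=> fg a b; rewrite fg. Qed.

Lemma tensorlr_commuting A B : commuting (@tensorl A B) (@tensorr A B).
Proof. by move=> a b; rewrite tensorlr [RHS]pureM mulr1 mul1r. Qed.

Lemma morphism_commuting A B C D (h : C -> D) (f : A -> C) (g : B -> C) :
  algebra_morphism h -> commuting f g -> commuting (h \o f) (h \o g).
Proof. by move=> [_ hM _] fg a b; rewrite /= -!hM fg. Qed.

(* Leg embeddings, pairings and iterated coproducts are all instances of tlift:  *)
(* R_{ij} is the lift of the i-th and j-th inclusions of H in H (x) (H (x) H),   *)
(* and (eta (x) id)(Q) is the lift of x |-> eta(x) 1 and the identity.           *)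
Definition tlift A B C (f : A -> C) (g : B -> C) (t : A \ox B) : C :=
  \tsum_(a, b <~ t) (f a * g b).

Lemma tlift_continuous A B C (f : A -> C) (g : B -> C) :
  continuous_linear f -> continuous_linear g -> continuous_linear (tlift f g).
Proof. by move=> cf cg; apply/tsum_continuous/mul_continuous_bilinear. Qed.

Lemma tlift_pure A B C (f : A -> C) (g : B -> C) a b :
  continuous_linear f -> continuous_linear g ->
  tlift f g (a \ox b) = f a * g b.
Proof. by move=> cf cg; apply/tsum_pure/mul_continuous_bilinear. Qed.

(** Separate continuity is enough: each variable is reduced to pure tensors while the other is held
    fixed. *)
Lemma tensor_ext2 A B A' B' C (f g : A \ox B -> A' \ox B' -> C) :
  (forall u, continuous_linear (f^~ u)) -> (forall u, continuous_linear (g^~ u)) ->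
  (forall t, continuous_linear (f t)) -> (forall t, continuous_linear (g t)) ->
  (forall a b a' b', f (a \ox b) (a' \ox b') = g (a \ox b) (a' \ox b')) ->
  forall t u, f t u = g t u.
Proof.
move=> f1 g1 f2 g2 e t u; apply: (tensor_ext (f1 u) (g1 u) _ t) => a b.
exact: (tensor_ext (f2 (a \ox b)) (g2 (a \ox b)) (e a b) u).
Qed.

(** The existence half of the universal property of the tensor product of algebras; commutation is
    what lets g(b) pass f(a'). *)
Lemma tlift_morphism A B C (f : A -> C) (g : B -> C) :
  algebra_morphism f -> algebra_morphism g -> commuting f g ->
  algebra_morphism (tlift f g).
Proof.
move=> [cf fM f1] [cg gM g1] fg; have cfg := tlift_continuous cf cg.
split=> //; last by rewrite -pure1 tlift_pure // f1 g1 mulr1.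
apply: (tensor_ext2 (f := fun t u => tlift f g (t * u))
  (g := fun t u => tlift f g t * tlift f g u)).
- by move=> u; apply: continuous_linear_comp => //; apply: continuous_linear_rmul.
- move=> u; apply: (continuous_linear_comp (g := fun x => x * _)) => //.
  exact: continuous_linear_rmul.
- by move=> t; apply: continuous_linear_comp => //; apply: continuous_linear_lmul.
- move=> u; apply: (continuous_linear_comp (g := fun x => _ * x)) => //.
  exact: continuous_linear_lmul.
move=> a b a' b'; rewrite pureM !tlift_pure // fM gM.
by rewrite !mulrA -[f a * f a' * g b]mulrA fg !mulrA.
Qed.

Lemma morphism_tlift A B C D (h : C -> D) (f : A -> C) (g : B -> C) t :
  algebra_morphism h -> continuous_linear f -> continuous_linear g ->
  h (tlift f g t) = tlift (h \o f) (h \o g) t.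
Proof.
move=> [ch hM _] cf cg; rewrite linear_tsum //; last exact: mul_continuous_bilinear.
by apply: eq_tsum => a b; rewrite hM.
Qed.

Lemma tlift_id A B (t : A \ox B) : tlift (@tensorl A B) (@tensorr A B) t = t.
Proof.
have cl := morphism_continuous (@tensorl_morphism A B).
have cr := morphism_continuous (@tensorr_morphism A B).
apply: (tensor_ext (tlift_continuous cl cr) (@continuous_linear_id K _)) => a b.
by rewrite tlift_pure // tensorlr.
Qed.

Lemma eq_tlift A B C (f f' : A -> C) (g g' : B -> C) t :
  f =1 f' -> g =1 g' -> tlift f g t = tlift f' g' t.
Proof. by move=> e e'; apply: eq_tsum => a b; rewrite e e'. Qed.

Lemma tliftMl A B C (f : A -> C) (g : B -> C) c t :
  continuous_linear f -> continuous_linear g ->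
  c * tlift f g t = tlift (fun a => c * f a) g t.
Proof.
move=> cf cg; rewrite (linear_tsum _ (continuous_linear_lmul c)).
  by apply: eq_tsum => a b; rewrite mulrA.
exact: mul_continuous_bilinear.
Qed.

Lemma tliftMr A B C (f : A -> C) (g : B -> C) c t :
  continuous_linear f -> continuous_linear g ->
  tlift f g t * c = tlift f (fun b => g b * c) t.
Proof.
move=> cf cg; rewrite (linear_tsum _ (continuous_linear_rmul c)).
  by apply: eq_tsum => a b; rewrite mulrA.
exact: mul_continuous_bilinear.
Qed.

(** Open sets are two-sided ideals, so [W] itself serves as the neighbourhood of 0: every term f(a)
    x g(b) stays in it. This allows the middle factor [x] to be reduced to pure tensors when the
    legs of [t] surround it. *)
Lemma sandwich_continuous A B C (f : A -> C) (g : B -> C) t :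
  continuous_linear f -> continuous_linear g ->
  continuous_linear (fun x => tlift (fun a => f a * x) g t).
Proof.
move=> cf cg.
have cfx x : continuous_bilinear (fun a b => f a * x * g b).
  apply: mul_continuous_bilinear => //.
  exact: (continuous_linear_comp (continuous_linear_rmul x) cf).
have e c x y a b : f a * (c *: x + y) * g b = c *: (f a * x * g b) + f a * y * g b.
  by rewrite mulrDr mulrDl -ctscalerAr -ctscalerAl.
split=> [c x y|W oW].
  rewrite /tlift -tsum_lincomb // => [|]; last first.
    by under eq_fun do (under eq_fun do rewrite -e).
  by apply: eq_tsum => a b.
exists W => // x Wx; apply: tsum_opn => // a b; apply: opnMr => //.
exact: opnMl.
Qed.

Lemma tlift_commuting A B C D (f : A -> C) (g : B -> C) (h : D -> C) :
  continuous_linear f -> continuous_linear g ->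
  commuting f h -> commuting g h -> commuting (tlift f g) h.
Proof.
move=> cf cg fh gh t d; rewrite tliftMl // tliftMr //.
apply: eq_tsum => a b; by rewrite gh mulrA fh.
Qed.

Lemma tsum_mulE A B C (f : A -> B -> C) t u : continuous_bilinear f ->
  tsum f (t * u) = \tsum_(a, b <~ t) \tsum_(c, d <~ u) f (a * c) (b * d).
Proof.
move=> cf; have ct := tsum_continuous cf.
have e a b : \tsum_(c, d <~ u) f (a * c) (b * d) = tsum f (a \ox b * u).
  have cL := continuous_linear_comp ct (continuous_linear_lmul (a \ox b)).
  (* [u] is the sum of its own pure tensors, so the linear map applied to it can be taken under the
     sum. *)
  have := linear_tsum u cL (@pure_continuous_bilinear K A B).
  rewrite (_ : tsum _ u = u) => [->|].
    by apply: eq_tsum => c d; rewrite pureM tsum_pure.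
  rewrite -[RHS]tlift_id; apply: eq_tsum => c d; exact/esym/tensorlr.
have cR := continuous_linear_comp ct (continuous_linear_rmul u).
rewrite (eq_tsum _ e).
have cb := comp_continuous_bilinear cR (@pure_continuous_bilinear K A B).
apply: (tensor_ext cR (tsum_continuous cb)) => a b.
by rewrite tsum_pure.
Qed.

End Lift.

(** * The three positions in a triple tensor product *)

Section Legs.
Variables (K : ctRingType) (A : ctAlgType K).
Local Notation T3 := (A \ox (A \ox A))%type.

Definition pos1 : A -> T3 := @tensorl K A (A \ox A)%type.
Definition pos2 : A -> T3 := @tensorr K A (A \ox A)%type \o @tensorl K A A.
Definition pos3 : A -> T3 := @tensorr K A (A \ox A)%type \o @tensorr K A A.

Lemma pos1_morphism : algebra_morphism pos1.
Proof. exact: tensorl_morphism. Qed.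

Lemma pos2_morphism : algebra_morphism pos2.
Proof.
exact: algebra_morphism_comp (@tensorr_morphism K A _) (@tensorl_morphism K A A).
Qed.

Lemma pos3_morphism : algebra_morphism pos3.
Proof.
exact: algebra_morphism_comp (@tensorr_morphism K A _) (@tensorr_morphism K A A).
Qed.

Lemma pos12_commuting : commuting pos1 pos2.
Proof. by move=> a b; apply: tensorlr_commuting. Qed.

Lemma pos13_commuting : commuting pos1 pos3.
Proof. by move=> a b; apply: tensorlr_commuting. Qed.

Lemma pos23_commuting : commuting pos2 pos3.
Proof.
exact: morphism_commuting (@tensorr_morphism K A _) (@tensorlr_commuting K A A).
Qed.

Lemma tlift_pos23 : tlift pos2 pos3 =1 @tensorr K A (A \ox A)%type.
Proof.
move=> t; rewrite -[in RHS](tlift_id t); apply/esym/morphism_tlift.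
- exact: tensorr_morphism.
- exact/morphism_continuous/tensorl_morphism.
- exact/morphism_continuous/tensorr_morphism.
Qed.

Lemma pos123 a b c : pos1 a * (pos2 b * pos3 c) = a \ox (b \ox c).
Proof.
case: (@tensorr_morphism K A (A \ox A)%type) => _ rM _.
by rewrite -rM !tensorlr.
Qed.

Section Lift3.
Variables (B : ctAlgType K) (f g h : A -> B).
Hypotheses (fm : algebra_morphism f) (gm : algebra_morphism g)
  (hm : algebra_morphism h).

(** Meaningful for maps that are only linear: besides moving R_{ij} to other positions, it serves to
    apply functionals to the legs and the antipode to one leg. *)
Definition lift3 : T3 -> B := tlift f (tlift g h).

Let cf := morphism_continuous fm.
Let cg := morphism_continuous gm.
Let ch := morphism_continuous hm.
Let cgh := tlift_continuous cg ch.

Lemma lift3_pos1 : lift3 \o pos1 =1 f.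
Proof.
move=> a; rewrite /= /lift3 tlift_pure // -pure1 tlift_pure //.
by case: gm hm => _ _ -> [_ _ ->]; rewrite !mulr1.
Qed.

Lemma lift3_pos2 : lift3 \o pos2 =1 g.
Proof.
move=> a; rewrite /= /lift3 tlift_pure // tlift_pure //.
by case: fm hm => _ _ -> [_ _ ->]; rewrite mulr1 mul1r.
Qed.

Lemma lift3_pos3 : lift3 \o pos3 =1 h.
Proof.
move=> a; rewrite /= /lift3 tlift_pure // tlift_pure //.
by case: fm gm => _ _ -> [_ _ ->]; rewrite !mul1r.
Qed.

Hypotheses (fg : commuting f g) (fh : commuting f h) (gh : commuting g h).

Lemma lift3_morphism : algebra_morphism lift3.
Proof.
apply: tlift_morphism => //; first exact: tlift_morphism.
by apply/commutingC/tlift_commuting => //; apply: commutingC.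
Qed.

Lemma lift3_leg12 t : lift3 (tlift pos1 pos2 t) = tlift f g t.
Proof.
rewrite (morphism_tlift _ lift3_morphism); last 2 first.
- exact/morphism_continuous/pos1_morphism.
- exact/morphism_continuous/pos2_morphism.
exact: eq_tlift lift3_pos1 lift3_pos2.
Qed.

Lemma lift3_leg13 t : lift3 (tlift pos1 pos3 t) = tlift f h t.
Proof.
rewrite (morphism_tlift _ lift3_morphism); last 2 first.
- exact/morphism_continuous/pos1_morphism.
- exact/morphism_continuous/pos3_morphism.
exact: eq_tlift lift3_pos1 lift3_pos3.
Qed.

Lemma lift3_leg23 t : lift3 (tlift pos2 pos3 t) = tlift g h t.
Proof.
rewrite (morphism_tlift _ lift3_morphism); last 2 first.
- exact/morphism_continuous/pos2_morphism.
- exact/morphism_continuous/pos3_morphism.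
exact: eq_tlift lift3_pos2 lift3_pos3.
Qed.
End Lift3.

End Legs.

(** * The Hopf algebra structure in terms of lifts *)

Section Hopf.
Variables (K : ctRingType) (H : hopfAlgType K).
Implicit Types (C : ctAlgType K) (t : (H \ox H)%type).

Local Notation pos1 := (@pos1 K H).
Local Notation pos2 := (@pos2 K H).
Local Notation pos3 := (@pos3 K H).
Local Notation tensorl := (@tensorl K H H).
Local Notation tensorr := (@tensorr K H H).

Let mpos1 : algebra_morphism pos1 := @pos1_morphism K H.
Let mpos2 : algebra_morphism pos2 := @pos2_morphism K H.
Let mpos3 : algebra_morphism pos3 := @pos3_morphism K H.
Let p12 : commuting pos1 pos2 := @pos12_commuting K H.
Let p13 : commuting pos1 pos3 := @pos13_commuting K H.
Let p23 : commuting pos2 pos3 := @pos23_commuting K H.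
Let cpos1 : continuous_linear pos1 := morphism_continuous mpos1.
Let cpos2 : continuous_linear pos2 := morphism_continuous mpos2.
Let cpos3 : continuous_linear pos3 := morphism_continuous mpos3.
Let mleg12 : algebra_morphism (tlift pos1 pos2) := tlift_morphism mpos1 mpos2 p12.
Let mleg13 : algebra_morphism (tlift pos1 pos3) := tlift_morphism mpos1 mpos3 p13.
Let mleg23 : algebra_morphism (tlift pos2 pos3) := tlift_morphism mpos2 mpos3 p23.
Let cleg12 : continuous_linear (tlift pos1 pos2) := morphism_continuous mleg12.
Let cleg13 : continuous_linear (tlift pos1 pos3) := morphism_continuous mleg13.
Let cleg23 : continuous_linear (tlift pos2 pos3) := morphism_continuous mleg23.
Let ml : algebra_morphism tensorl := @tensorl_morphism K H H.
Let mr : algebra_morphism tensorr := @tensorr_morphism K H H.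
Let cl : continuous_linear tensorl := morphism_continuous ml.
Let cr : continuous_linear tensorr := morphism_continuous mr.
Let mD : algebra_morphism (@coproduct K H) := @coproduct_morphism K H.
Let cD : continuous_linear (@coproduct K H) := morphism_continuous mD.
Let cS : continuous_linear (@antipode K H) := @antipode_continuous K H.
Let me : algebra_morphism (@counit K H) := @counit_morphism K H.
Let ce : continuous_linear (@counit K H) := morphism_continuous me.

(** The values are central, so a leg sent to scalars commutes with every other position, whatever
    [e] is. *)
Definition scalar C (e : H -> K^o) : H -> C := fun x => e x *: (1 : C).

Lemma scalar_continuous C (e : H -> K^o) :
  continuous_linear e -> continuous_linear (@scalar C e).
Proof. exact: scale_continuous. Qed.

Lemma scalar_commuting C (D : ctAlgType K) (e : H -> K^o) (f : D -> C) :
  commuting (@scalar C e) f.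
Proof.
by move=> a b; rewrite /scalar -ctscalerAl -ctscalerAr mul1r mulr1.
Qed.

Lemma scalar_mul C (e : H -> K^o) x (y : C) : scalar C e x * y = e x *: y.
Proof. by rewrite /scalar -ctscalerAl mul1r. Qed.

Lemma scalar_counit_morphism C : algebra_morphism (@scalar C counit).
Proof.
case: me => _ eM e1; split; first exact: scalar_continuous.
  by move=> x y; rewrite scalar_mul /scalar eM scalerA.
by rewrite /scalar e1 scale1r.
Qed.

Lemma morphism_scalar C (D : ctAlgType K) (h : C -> D) (e : H -> K^o) :
  algebra_morphism h -> h \o scalar C e =1 scalar D e.
Proof.
by move=> [ch _ h1] x; rewrite /= /scalar linear_continuousZ // h1.
Qed.

Lemma tflipE t : tflip t = tlift tensorr tensorl t.
Proof. by apply: eq_tsum => a b; rewrite -tensorlr_commuting tensorlr. Qed.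

Lemma tflip_morphism : algebra_morphism (@tflip K H).
Proof.
rewrite (_ : @tflip K H = tlift tensorr tensorl); last exact/funext/tflipE.
by apply: tlift_morphism => //; apply/commutingC/tensorlr_commuting.
Qed.

Lemma tflip_pure (a b : H) : tflip (a \ox b) = b \ox a.
Proof. by rewrite tflipE tlift_pure // -tensorlr_commuting tensorlr. Qed.

Lemma tsum_tflip C (f : H -> H -> C) t : continuous_bilinear f ->
  tsum f (tflip t) = \tsum_(a, b <~ t) f b a.
Proof.
move=> cf; have cf' := swap_continuous_bilinear cf.
apply: (tensor_ext (L := tsum f \o @tflip K H) _ (tsum_continuous cf')).
  exact: comp_continuous (tsum_continuous cf) (morphism_continuous tflip_morphism).
by move=> a b; rewrite /= tflip_pure !tsum_pure.
Qed.

Lemma tlift_tflip C (f g : H -> C) t :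
  continuous_linear f -> continuous_linear g -> commuting f g ->
  tlift f g (tflip t) = tlift g f t.
Proof.
move=> cf cg fg; rewrite /tlift tsum_tflip; last exact: mul_continuous_bilinear.
by apply: eq_tsum => a b; rewrite fg.
Qed.

Lemma tlift_coproduct_id C (f g h : H -> C) t :
  continuous_linear f -> continuous_linear g -> continuous_linear h ->
  lift3 f g h (coproduct_id t) = tlift (tlift f g \o coproduct) h t.
Proof.
move=> cf cg ch.
have e a b : \tsum_(a1, a2 <~ coproduct a) (a1 \ox (a2 \ox b)) =
    (tlift pos1 pos2 \o coproduct) a * pos3 b.
  rewrite tliftMr //; apply: eq_tsum => u v.
  by rewrite pos123.
have c3 : continuous_linear (lift3 f g h).
  by apply: tlift_continuous => //; apply: tlift_continuous.
rewrite /coproduct_id (eq_tsum _ e) linear_tsum //; last first.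
  by apply: mul_continuous_bilinear => //; apply: comp_continuous.
apply: eq_tsum => a b; rewrite /= !tliftMr //.
rewrite linear_tsum //; last first.
  apply: mul_continuous_bilinear => //.
  exact: (continuous_linear_comp (continuous_linear_rmul _) cpos2).
apply: eq_tsum => u v; rewrite pos123.
by rewrite /lift3 !tlift_pure //; apply: tlift_continuous.
Qed.

Lemma tlift_id_coproduct C (f g h : H -> C) t :
  continuous_linear f -> continuous_linear g -> continuous_linear h ->
  lift3 f g h (id_coproduct t) = tlift f (tlift g h \o coproduct) t.
Proof.
move=> cf cg ch; have cgh := tlift_continuous cg ch.
have e a b : a \ox coproduct b = pos1 a * (tlift pos2 pos3 \o coproduct) b.
  by rewrite /= tlift_pos23 [RHS]tensorlr.
rewrite /id_coproduct (eq_tsum _ e) linear_tsum; last 2 first.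
- exact: tlift_continuous.
- by apply: mul_continuous_bilinear => //; apply: comp_continuous.
by apply: eq_tsum => a b; rewrite -e /lift3 tlift_pure.
Qed.

Lemma tlift_coassoc C (f g h : H -> C) (x : H) :
  continuous_linear f -> continuous_linear g -> continuous_linear h ->
  tlift (tlift f g \o coproduct) h (coproduct x) =
  tlift f (tlift g h \o coproduct) (coproduct x).
Proof.
move=> cf cg ch.
rewrite -(tlift_coproduct_id _ cf cg ch) -(tlift_id_coproduct _ cf cg ch).
(* By unfolding, the two sides of coassociativity are [coproduct_id] and [id_coproduct] of
   [coproduct x]. *)
congr (lift3 f g h _); exact: coassociative.
Qed.

Lemma tlift_counitl C (f : H -> C) (x : H) : continuous_linear f ->
  tlift (scalar C counit) f (coproduct x) = f x.
Proof.
move=> cf; rewrite -[in RHS](counitl x) linear_tsum //.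
  by apply: eq_tsum => a b; rewrite scalar_mul linear_continuousZ.
under eq_fun do (under eq_fun do rewrite -scalar_mul).
apply: mul_continuous_bilinear; first exact: scalar_continuous.
exact: continuous_linear_id.
Qed.

Lemma tlift_counitr C (f : H -> C) (x : H) : continuous_linear f ->
  tlift f (scalar C counit) (coproduct x) = f x.
Proof.
move=> cf; rewrite -[in RHS](counitr x) linear_tsum //.
  by apply: eq_tsum => a b; rewrite -scalar_commuting scalar_mul linear_continuousZ.
apply: swap_continuous_bilinear.
under eq_fun do (under eq_fun do rewrite -scalar_mul).
apply: mul_continuous_bilinear; first exact: scalar_continuous.
exact: continuous_linear_id.
Qed.

Lemma tlift_antipodel C (f : H -> C) (x : H) : algebra_morphism f ->
  tlift (f \o antipode) f (coproduct x) = scalar C counit x.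
Proof.
move=> mf; rewrite -(morphism_scalar counit mf) /= /scalar -antipodel.
exact/esym/(morphism_tlift _ mf cS)/continuous_linear_id.
Qed.

Lemma tlift_antipoder C (f : H -> C) (x : H) : algebra_morphism f ->
  tlift f (f \o antipode) (coproduct x) = scalar C counit x.
Proof.
move=> mf; rewrite -(morphism_scalar counit mf) /= /scalar -antipoder.
exact/esym/(morphism_tlift _ mf)/cS/continuous_linear_id.
Qed.

Lemma leg12E t : leg12 t = tlift pos1 pos2 t.
Proof.
apply: eq_tsum => a b.
by case: mpos3 => _ _ p1; rewrite -[pos2 b]mulr1 -p1 pos123.
Qed.

Lemma leg13E t : leg13 t = tlift pos1 pos3 t.
Proof.
apply: eq_tsum => a b.
by case: mpos2 => _ _ p1; rewrite -[pos3 b]mul1r -p1 pos123.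
Qed.

Lemma leg23E t : leg23 t = tlift pos2 pos3 t.
Proof. by rewrite tlift_pos23. Qed.

Lemma tflipK : involutive (@tflip K H).
Proof.
move=> t; rewrite {1}tflipE tlift_tflip ?tlift_id //.
exact/commutingC/tensorlr_commuting.
Qed.

(** * Identities for R and Q in arbitrary commuting positions *)

Section RMatrix.
Variables (R : (H \ox H)%type) (qR : quasitriangular R).

(** R turns Delta(x) into its opposite, and the flip of the same relation shows that R_{21} turns it
    back. *)
Lemma q_element_coproduct x :
  q_element R * coproduct x = coproduct x * q_element R.
Proof.
have [_ fM _] := tflip_morphism.
rewrite /q_element -mulrA (quasi_coproduct qR) !mulrA -fM.
by rewrite (quasi_coproduct qR) fM tflipK.
Qed.

Section Positions.
Variables (C : ctAlgType K) (f g h : H -> C).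
Hypotheses (mf : algebra_morphism f) (mg : algebra_morphism g)
  (mh : algebra_morphism h).
Hypotheses (fg : commuting f g) (fh : commuting f h) (gh : commuting g h).

Let cf := morphism_continuous mf.
Let cg := morphism_continuous mg.
Let ch := morphism_continuous mh.
Let mfg : algebra_morphism (tlift f g) := tlift_morphism mf mg fg.
Let mgh : algebra_morphism (tlift g h) := tlift_morphism mg mh gh.
Let m3 : algebra_morphism (lift3 f g h) := lift3_morphism mf mg mh fg fh gh.

Lemma tlift_coproduct_id_R :
  tlift (tlift f g \o coproduct) h R = tlift f h R * tlift g h R.
Proof.
case: m3 => _ mM _; rewrite -tlift_coproduct_id // (quasi_coproduct_id qR) mM.
by rewrite leg13E leg23E lift3_leg13 // lift3_leg23.
Qed.

Lemma tlift_id_coproduct_R :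
  tlift f (tlift g h \o coproduct) R = tlift f h R * tlift f g R.
Proof.
case: m3 => _ mM _; rewrite -tlift_id_coproduct // (quasi_id_coproduct qR) mM.
by rewrite leg13E leg12E lift3_leg13 // lift3_leg12.
Qed.

(** R exchanges Delta with its opposite in positions f and g, and it passes the third position
    because [h] commutes with both. *)
Lemma R_swap_coproduct t :
  tlift f g R * tlift (tlift f g \o coproduct) h t =
  tlift (tlift g f \o coproduct) h t * tlift f g R.
Proof.
have cfgD : continuous_linear (tlift f g \o coproduct).
  exact: comp_continuous (morphism_continuous mfg) cD.
have cgfD : continuous_linear (tlift g f \o coproduct).
  exact: comp_continuous (tlift_continuous cg cf) cD.
case: mfg => _ fgM _.
rewrite tliftMl // tliftMr //; apply: eq_tsum => a b.
rewrite /= -fgM (quasi_coproduct qR) fgM tlift_tflip // -!mulrA.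
by congr (_ * _); apply: tlift_commuting.
Qed.

Lemma tlift_q_element : tlift g h (q_element R) = tlift h g R * tlift g h R.
Proof. by case: mgh => _ ghM _; rewrite ghM tlift_tflip. Qed.

Lemma q_element_swap_coproduct t :
  tlift g h (q_element R) * tlift f (tlift g h \o coproduct) t =
  tlift f (tlift g h \o coproduct) t * tlift g h (q_element R).
Proof.
have cghD : continuous_linear (tlift g h \o coproduct).
  exact: comp_continuous (morphism_continuous mgh) cD.
case: mgh => _ ghM _.
have ghf : commuting (tlift g h) f by apply: tlift_commuting => //; apply: commutingC.
rewrite tliftMl // tliftMr //; apply: eq_tsum => a b.
by rewrite ghf -mulrA /= -!ghM q_element_coproduct.
Qed.

End Positions.

(* R12 (Delta (x) id)(Q) = R12 R32 R31 R13 R23 = R31 R32 R23 R13 R12, and the   *)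
(* middle factor R32 R23 commutes with R13 R12 = (id (x) Delta)(R).            *)
Lemma R_coproduct_q_element C (f g h : H -> C) :
  algebra_morphism f -> algebra_morphism g -> algebra_morphism h ->
  commuting f g -> commuting f h -> commuting g h ->
  tlift f g R * tlift (tlift f g \o coproduct) h (q_element R) =
  tlift f h (q_element R) * tlift f g R * tlift g h (q_element R).
Proof.
move=> mf mg mh fg fh gh.
have cf := morphism_continuous mf; have cg := morphism_continuous mg.
have ch := morphism_continuous mh.
have gf := commutingC fg; have hf := commutingC fh; have hg := commutingC gh.
have mgf := tlift_morphism mg mf gf.
have cgf := morphism_continuous mgf.
have mgfD := algebra_morphism_comp mgf mD.
have cgfDh : commuting (tlift g f \o coproduct) h.
  by move=> a b; apply: tlift_commuting.
have [_ M _] := tlift_morphism mgfD mh cgfDh.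
have hgfR := tlift_id_coproduct_R mh mg mf hg hf gf.
have gfhR := tlift_coproduct_id_R mg mf mh gf gh fh.
have fghR := tlift_id_coproduct_R mf mg mh fg fh gh.
rewrite R_swap_coproduct // M tlift_tflip //; last exact: morphism_continuous.
rewrite hgfR gfhR -!mulrA -fghR [tlift h g R * _]mulrA.
rewrite -(tlift_q_element mg mh gh) q_element_swap_coproduct // fghR.
by rewrite !mulrA -(tlift_q_element mf mh fh).
Qed.

(** Let e = (epsilon (x) id)(R). The counit on the first leg of (Delta (x) id)(R) = R_{13} R_{23}
    gives R = (1 (x) e) R, and R is invertible, so 1 (x) e = 1. Applying epsilon (x) id once more
    yields e = 1, from which the case of a general [f] follows. *)
Lemma R_counitl C (f : H -> C) : algebra_morphism f ->
  tlift (scalar C counit) f R = 1.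
Proof.
move=> mf; have [R' [RR' _]] := quasi_unit qR.
have me1 (D : ctAlgType K) := @scalar_counit_morphism D.
have ce1 (D : ctAlgType K) := morphism_continuous (me1 D).
pose e := tlift (scalar H counit) (@id H) R.
have e1 : e = 1.
  have cR : tensorr e * R = R.
    have := tlift_coproduct_id_R (me1 _) ml mr (@scalar_commuting _ _ _ _)
      (@scalar_commuting _ _ _ _) (@tensorlr_commuting K H H).
    rewrite tlift_id (eq_tlift (f' := tensorl) (g' := tensorr)) ?tlift_id //; last first.
      by move=> x; apply: tlift_counitl.
    rewrite /e (morphism_tlift _ mr (ce1 _) (@continuous_linear_id K H)) => e0.
    rewrite [RHS]e0.
    by congr (_ * _); apply: eq_tlift => // x; apply: morphism_scalar.
  have : tensorr e = 1 by rewrite -RR' -[in RHS]cR -mulrA RR' mulr1.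
  move/(congr1 (tlift (scalar _ counit) (@id H))).
  have [cL _ ->] :=
    tlift_morphism (me1 H) (@algebra_morphism_id K H)
      (@scalar_commuting _ _ _ _).
  rewrite tlift_pure //; last exact: continuous_linear_id.
  by have [_ _ ->] := me1 H; rewrite mul1r.
have := morphism_tlift R mf (ce1 H) (@continuous_linear_id K H).
rewrite -/e e1; have [_ _ ->] := mf => ->.
by apply: eq_tlift => // x; rewrite morphism_scalar.
Qed.

Lemma R_counitr C (f : H -> C) : algebra_morphism f ->
  tlift f (scalar C counit) R = 1.
Proof.
move=> mf; have [R' [RR' _]] := quasi_unit qR.
have me1 (D : ctAlgType K) := @scalar_counit_morphism D.
have ce1 (D : ctAlgType K) := morphism_continuous (me1 D).
pose e := tlift (@id H) (scalar H counit) R.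
have e1 : e = 1.
  have cR : tensorl e * R = R.
    have := tlift_id_coproduct_R ml mr (me1 _) (@tensorlr_commuting K H H)
      (commutingC (@scalar_commuting _ _ _ _)) (commutingC (@scalar_commuting _ _ _ _)).
    rewrite tlift_id (eq_tlift (f' := tensorl) (g' := tensorr)) ?tlift_id //; last first.
      by move=> x; apply: tlift_counitr.
    rewrite /e (morphism_tlift _ ml (@continuous_linear_id K H) (ce1 _)) => e0.
    rewrite [RHS]e0.
    by congr (_ * _); apply: eq_tlift => // x; apply: morphism_scalar.
  have : tensorl e = 1 by rewrite -RR' -[in RHS]cR -mulrA RR' mulr1.
  move/(congr1 (tlift (@id H) (scalar _ counit))).
  have [cL _ ->] :=
    tlift_morphism (@algebra_morphism_id K H) (me1 H)
      (commutingC (@scalar_commuting _ _ _ _)).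
  rewrite tlift_pure //; last exact: continuous_linear_id.
  by have [_ _ ->] := me1 H; rewrite mulr1.
have := morphism_tlift R mf (@continuous_linear_id K H) (ce1 H).
rewrite -/e e1; have [_ _ ->] := mf => ->.
by apply: eq_tlift => // x; rewrite morphism_scalar.
Qed.

(* r_1 s_1 (x) gamma(s_2) r_2 = 1 for two copies r, s of R: apply               *)
(* x (x) y (x) z |-> x (x) gamma(y) z to (id (x) Delta)(R) = R13 R12.           *)
Lemma R_sandwich C (f g : H -> C) :
  algebra_morphism f -> algebra_morphism g -> commuting f g ->
  tlift (fun u => (g \o antipode) u * tlift f g R) f (tflip R) = 1.
Proof.
move=> mf mg fg.
have [cf fM f1] := mf; have [cg gM g1] := mg.
have cgS := comp_continuous cg cS.
have cgg := tlift_continuous cgS cg; have cfg := tlift_continuous cf cg.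
have c3 : continuous_linear (lift3 f (g \o antipode) g) by apply: tlift_continuous.
(* The two copies of R become independent variables, since passage to pure tensors treats them one
   at a time. The flip is there because the second leg of [r] multiplies on the left and the first
   on the right. *)
have key s r : lift3 f (g \o antipode) g (tlift pos1 pos3 s * tlift pos1 pos2 r) =
    tlift (fun u => (g \o antipode) u * tlift f g s) f (tflip r).
  move: s r; apply: (tensor_ext2 (f := fun s r =>
    lift3 f (g \o antipode) g (tlift pos1 pos3 s * tlift pos1 pos2 r))
    (g := fun s r => tlift (fun u => (g \o antipode) u * tlift f g s) f (tflip r))).
  - move=> u; apply: (continuous_linear_comp c3 (f := fun s => tlift pos1 pos3 s * _)).
    exact: (continuous_linear_comp (continuous_linear_rmul _) cleg13).
  - move=> u; apply: (continuous_linear_comp (f := tlift f g)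
      (g := fun x => tlift (fun u => (g \o antipode) u * x) f (tflip _))) => //.
    exact: sandwich_continuous.
  - move=> s; apply: (continuous_linear_comp c3 (f := fun r => _ * tlift pos1 pos2 r)).
    exact: (continuous_linear_comp (continuous_linear_lmul _) cleg12).
  - move=> s; apply: (continuous_linear_comp (f := @tflip K H)
      (g := tlift (fun u => (g \o antipode) u * tlift f g s) f)).
      apply: tlift_continuous => //.
      exact: (continuous_linear_comp (continuous_linear_rmul _) cgS).
    exact: morphism_continuous tflip_morphism.
  move=> a b a' b'; rewrite tflip_pure !tlift_pure //; last first.
    exact: (continuous_linear_comp (continuous_linear_rmul _) cgS).
  have [_ M1 _] := mpos1.
  rewrite mulrA -[pos1 a * _ * _]mulrA -p13 [pos1 a * (_ * _)]mulrA.
  rewrite -[_ * _ * pos2 _]mulrA -p23 -M1 pos123 /lift3 !tlift_pure //=.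
  by rewrite -gM fg gM fM -!mulrA; congr (_ * _); rewrite !mulrA fg.
have := key R R; rewrite -leg13E -leg12E -(quasi_id_coproduct qR) tlift_id_coproduct //.
rewrite (eq_tlift _ (frefl f) (g' := scalar C counit)) => [|x];
  last exact: tlift_antipodel.
by rewrite R_counitr.
Qed.

End RMatrix.

(** * The map attached to Q: linearity *)

Lemma q_mapE R (a : dual H) :
  q_map R a = tlift (scalar H a) id (q_element R).
Proof. by apply: eq_tsum => x y; rewrite scalar_mul. Qed.

Lemma dual_scalar_continuous C (a : dual H) : continuous_linear (scalar C a).
Proof. exact/scalar_continuous/dual_continuous/dual_in. Qed.

Let cid : continuous_linear (@id H) := @continuous_linear_id K H.

Lemma q_map_linear R : linear (q_map R : dual H -> H).
Proof.
have cm (a : dual H) : continuous_bilinear (fun x y : H => a x *: y).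
  under eq_fun do (under eq_fun do rewrite -scalar_mul).
  by apply: mul_continuous_bilinear => //; apply: dual_scalar_continuous.
move=> c a b; rewrite /q_map -tsum_lincomb //.
  by apply: eq_tsum => x y; rewrite scalerDl scalerA.
by under eq_fun do (under eq_fun do rewrite scalerA -scalerDl); apply: (cm (c *: a + b)).
Qed.

(** * Multiplicativity *)

Section Multiplicative.
Variables (R : (H \ox H)%type) (qR : quasitriangular R) (a b : dual H).

(** This is a (x) b (x) id. *)
Definition eval2 : (H \ox (H \ox H))%type -> H :=
  lift3 (scalar H a) (scalar H b) id.

Let ca := dual_scalar_continuous H a.
Let cb := dual_scalar_continuous H b.

Lemma eval2_continuous : continuous_linear eval2.
Proof. by apply: tlift_continuous => //; apply: tlift_continuous. Qed.

(** [eval2] need not be multiplicative. Here, however, the first leg comes from [s] alone and the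
    second from [t] alone, so the only product is in the third leg, in the right order. *)
Lemma eval2_legs s t : eval2 (tlift pos1 pos3 s * tlift pos2 pos3 t) =
  tlift (scalar H a) id s * tlift (scalar H b) id t.
Proof.
have cE := eval2_continuous.
have cas := tlift_continuous ca cid; have cbs := tlift_continuous cb cid.
move: s t; apply: (tensor_ext2 (f := fun s t =>
  eval2 (tlift pos1 pos3 s * tlift pos2 pos3 t)) (g := fun s t =>
  tlift (scalar H a) id s * tlift (scalar H b) id t)).
- move=> u; apply: (continuous_linear_comp cE (f := fun s => tlift pos1 pos3 s * _)).
  exact: (continuous_linear_comp (continuous_linear_rmul _) cleg13).
- move=> u; exact: (continuous_linear_comp (continuous_linear_rmul _) cas).
- move=> s; apply: (continuous_linear_comp cE (f := fun t => _ * tlift pos2 pos3 t)).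
  exact: (continuous_linear_comp (continuous_linear_lmul _) cleg23).
- move=> s; exact: (continuous_linear_comp (continuous_linear_lmul _) cbs).
move=> x y x' y'; have [_ M3 _] := mpos3.
rewrite !tlift_pure // -[X in eval2 X]mulrA [pos3 y * _]mulrA -p23.
rewrite -[_ * pos3 y * _]mulrA -M3 pos123.
rewrite /eval2 /lift3 !tlift_pure //.
rewrite !scalar_mul -ctscalerAl; congr (_ *: _).
by rewrite ctscalerAr.
Qed.

Lemma eval2_leg12 t (z : H) : eval2 (tlift pos1 pos2 t * pos3 z) =
  (\tsum_(u, v <~ t) (a u * b v : K^o)) *: z.
Proof.
have cE := eval2_continuous.
have cab := mul_continuous_bilinear (dual_continuous (dual_in a))
  (dual_continuous (dual_in b)).
apply: (tensor_ext (L := fun t => eval2 (tlift pos1 pos2 t * pos3 z)) (L' := fun t =>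
  (\tsum_(u, v <~ t) (a u * b v : K^o)) *: z) _ _ _ t).
- apply: (continuous_linear_comp cE (f := fun s => tlift pos1 pos2 s * _)).
  exact: (continuous_linear_comp (continuous_linear_rmul _) cleg12).
- exact: scale_continuous (tsum_continuous cab).
move=> x y; rewrite tsum_pure // tlift_pure // -mulrA pos123.
rewrite /eval2 /lift3 !tlift_pure //; last exact: tlift_continuous.
by rewrite !scalar_mul scalerA.
Qed.

(** Used with p = gamma(r_2) and q = r_1, to move the coregular actions of r from the functionals to
    the tensor they are paired with. *)
Lemma redual_mul_fun_cycle (w : (H \ox H)%type) (p q : H) :
  \tsum_(u, v <~ tensorr p * w * tensorl q) (a u * b v : K^o) =
  \tsum_(u, v <~ w) (a (u * q) * b (p * v) : K^o).
Proof.
have cda := dual_continuous (dual_in a); have cdb := dual_continuous (dual_in b).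
have cab := mul_continuous_bilinear cda cdb.
have cab' := mul_continuous_bilinear
  (continuous_linear_comp cda (continuous_linear_rmul q))
  (continuous_linear_comp cdb (continuous_linear_lmul p)).
apply: (tensor_ext (L := fun w => \tsum_(u, v <~ tensorr p * w * tensorl q)
  (a u * b v : K^o)) _ (tsum_continuous cab') _ w).
  apply: (continuous_linear_comp (tsum_continuous cab)
    (f := fun w => tensorr p * w * tensorl q)).
  exact: (continuous_linear_comp (continuous_linear_rmul _) (continuous_linear_lmul _)).
by move=> x y; rewrite !pureM !tsum_pure // mul1r mulr1.
Qed.

(** With r and s the two copies of R, the coregular actions give m~(a (x) b)(y) = a(s_1 y_(1) r_1)
    b(gamma(r_2) s_2 y_(2)). Thus s multiplies Delta(y) on the left as R_{12}, while r surrounds the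
    product. The spectator [z] holds the place of the second leg of Q. *)
Lemma redual_mulE (y z : H) : redual_mul R a b y *: z =
  eval2 (tlift (fun u => (pos2 \o antipode) u *
    (tlift pos1 pos2 R * (tlift pos1 pos2 (coproduct y) * pos3 z))) pos1 (tflip R)).
Proof.
have cE := eval2_continuous.
have c2S : continuous_linear (pos2 \o antipode) by apply: comp_continuous.
have crS := comp_continuous cr cS.
have cda := dual_continuous (dual_in a); have cdb := dual_continuous (dual_in b).
have cab := mul_continuous_bilinear cda cdb.
have [_ M12 _] := mleg12.
have [_ _ p2] := mpos2; have [_ _ p1] := mpos1.
pose F (r1 r2 : H) : K^o :=
  \tsum_(u, v <~ tensorr (antipode r2) * (R * coproduct y) * tensorl r1)
    (a u * b v : K^o).
have cF : continuous_bilinear F.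
  apply: (comp_continuous_bilinear (tsum_continuous cab)).
  apply: (swap_continuous_bilinear (f := fun r2 r1 =>
    tensorr (antipode r2) * (R * coproduct y) * tensorl r1)).
  apply: mul_continuous_bilinear => //.
  exact: (continuous_linear_comp (continuous_linear_rmul _) crS).
have cuv x : continuous_bilinear (fun u v => (pos2 \o antipode) u * x * pos1 v).
  apply: mul_continuous_bilinear => //.
  exact: (continuous_linear_comp (continuous_linear_rmul _) c2S).
rewrite {2}/tlift linear_tsum // tsum_tflip; last exact: comp_continuous_bilinear.
transitivity (\tsum_(r1, r2 <~ R) (F r1 r2 *: z)).
  rewrite -(linear_tsum (L := fun k : K^o => k *: z)) //; last first.
    exact/scale_continuous/continuous_linear_id.
  congr (_ *: _); apply: eq_tsum => r1 r2; rewrite /F redual_mul_fun_cycle tsum_mulE //.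
  apply: mul_continuous_bilinear.
    exact: (continuous_linear_comp cda (continuous_linear_rmul _)).
  exact: (continuous_linear_comp cdb (continuous_linear_lmul _)).
apply: eq_tsum => r1 r2; rewrite -eval2_leg12 !M12; congr eval2.
rewrite /tensorr /tensorl !tlift_pure // p1 p2 mul1r mulr1 -!mulrA.
by rewrite -p13.
Qed.

Lemma q_mapM : q_map R (redual_mul R a b) = q_map R a * q_map R b.
Proof.
have cE := eval2_continuous.
have c2S : continuous_linear (pos2 \o antipode) by apply: comp_continuous.
have cD12 := comp_continuous cleg12 cD.
have cDh := tlift_continuous cD12 cpos3.
(* Extends [redual_mulE] from y (x) z to all tensors, so that Q can be substituted. *)
have key t : tlift (scalar H (redual_mul R a b)) id t =
    eval2 (tlift (fun u => (pos2 \o antipode) u * (tlift pos1 pos2 R *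
      tlift (tlift pos1 pos2 \o coproduct) pos3 t)) pos1 (tflip R)).
  apply: (tensor_ext (L' := fun t =>
    eval2 (tlift (fun u => (pos2 \o antipode) u * (tlift pos1 pos2 R *
      tlift (tlift pos1 pos2 \o coproduct) pos3 t)) pos1 (tflip R))) _ _ _ t).
  - by apply: tlift_continuous => //; apply: dual_scalar_continuous.
  - apply: (continuous_linear_comp cE (f := fun t =>
      tlift (fun u => (pos2 \o antipode) u * (tlift pos1 pos2 R *
      tlift (tlift pos1 pos2 \o coproduct) pos3 t)) pos1 (tflip R))).
    apply: (continuous_linear_comp (g := fun x =>
      tlift (fun u => (pos2 \o antipode) u * x) pos1 (tflip R))
      (f := fun t => tlift pos1 pos2 R * tlift (tlift pos1 pos2 \o coproduct) pos3 t)).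
      exact: sandwich_continuous.
    exact: (continuous_linear_comp (continuous_linear_lmul _) cDh).
  move=> y z; rewrite tlift_pure //; last exact: dual_scalar_continuous.
  by rewrite scalar_mul redual_mulE tlift_pure.
rewrite !q_mapE key R_coproduct_q_element // -eval2_legs.
congr eval2.
(* The factor 1 between Q_{13} and Q_{23} is expanded as gamma(r_2) R_{12} r_1, with gamma(r_2) in
   position 2 and r_1 in position 1. Then gamma(r_2) moves left past Q_{13} and r_1 moves right past
   Q_{23}, each commuting with positions other than its own. *)
rewrite -[X in _ = X * _]mulr1 -(R_sandwich qR mpos1 mpos2 p12).
have cX : continuous_linear (fun u => (pos2 \o antipode) u * tlift pos1 pos2 R).
  exact: (continuous_linear_comp (continuous_linear_rmul _) c2S).
rewrite [X in _ = X * _]tliftMl // [RHS]tliftMr //; last first.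
  exact: (continuous_linear_comp (continuous_linear_lmul _) cX).
apply: eq_tsum => u v.
have c13 : commuting (tlift pos1 pos3) pos2.
  by apply: tlift_commuting => //; apply: commutingC.
have c23 : commuting (tlift pos2 pos3) pos1.
  by apply: tlift_commuting => //; apply: commutingC.
rewrite -!mulrA c23 !mulrA; congr (_ * _ * _ * _).
by rewrite /= c13.
Qed.

End Multiplicative.

(** * Unit and equivariance *)

Lemma q_map1 R : quasitriangular R -> q_map R (dual_one H) = 1.
Proof.
move=> qR; rewrite q_mapE.
have mid := @algebra_morphism_id K H.
have me1 := scalar_counit_morphism H.
(* The counit is multiplicative, so its pairing with R_{21} R splits into two factors, each equal to
   1. *)
have [_ M _] := tlift_morphism me1 mid (@scalar_commuting _ _ _ _).
rewrite [LHS]M (R_counitl qR) // mulr1 tlift_tflip //; last exact: scalar_commuting.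
  exact: R_counitr.
exact: morphism_continuous.
Qed.

(** In Sweedler form, y_(1) (x) y_(2) gamma(y_(3)) = y (x) 1. It expresses y (x) 1 through
    coproducts, with which Q commutes. *)
Lemma tensorl_coproduct y :
  tlift coproduct (tensorr \o antipode) (coproduct y) = tensorl y.
Proof.
rewrite (eq_tlift (f' := tlift tensorl tensorr \o coproduct)
  (g' := tensorr \o antipode)) // => [|x]; last by rewrite /= tlift_id.
rewrite tlift_coassoc //; last exact: comp_continuous.
rewrite (eq_tlift _ (frefl _) (g' := scalar _ counit)).
  exact: tlift_counitr.
by move=> x; apply: tlift_antipoder.
Qed.

(** The mirror image: gamma(y_(1)) y_(2) (x) y_(3) = 1 (x) y. *)
Lemma tensorr_coproduct y :
  tlift (tensorl \o antipode) coproduct (coproduct y) = tensorr y.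
Proof.
rewrite (eq_tlift (f' := tensorl \o antipode)
  (g' := tlift tensorl tensorr \o coproduct)) // => [|x]; last by rewrite /= tlift_id.
rewrite -tlift_coassoc //; last exact: comp_continuous.
rewrite (eq_tlift (f' := scalar _ counit) _ _ (frefl _)).
  exact: tlift_counitl.
by move=> x; apply: tlift_antipodel.
Qed.

(* gamma(x_1) Q_1 x_2 (x) Q_2 = gamma(x_1) Q_1 x_2 (x) Q_2 x_3 gamma(x_4), and    *)
(* Q commutes with Delta(x_2).                                                 *)
Lemma q_element_ad R (qR : quasitriangular R) x :
  tlift (fun u => (tensorl \o antipode) u * q_element R) tensorl (coproduct x) =
  tlift (fun u => tensorr u * q_element R) (tensorr \o antipode) (coproduct x).
Proof.
have crS := comp_continuous cr cS; have clS := comp_continuous cl cS.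
have cf : continuous_linear (fun u => (tensorl \o antipode) u * q_element R).
  exact: (continuous_linear_comp (continuous_linear_rmul _) clS).
transitivity (tlift (fun u => (tensorl \o antipode) u * q_element R)
    (tlift coproduct (tensorr \o antipode) \o coproduct) (coproduct x)).
  by apply: eq_tlift => // y; rewrite /= tensorl_coproduct.
rewrite -tlift_coassoc //; apply: eq_tlift => // y.
rewrite /= -tensorr_coproduct tliftMr //; apply: eq_tsum => u v.
by rewrite -mulrA q_element_coproduct.
Qed.

(** The coadjoint action evaluates to a(gamma(x_(1)) y x_(2)), so on Q it acts on the first leg
    only; [q_element_ad] trades this for x_(1) Q_2 gamma(x_(2)) on the second leg, which is the
    adjoint action. The translations [key] and [key2] hold for every tensor; what is special to Q is
    the trade. *)
Lemma q_map_coadjoint R (qR : quasitriangular R) x (a : dual H) :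
  q_map R (coadjoint_action x a) = adjoint_action x (q_map R a).
Proof.
have ca := dual_scalar_continuous H a.
have cP := tlift_continuous ca cid.
have crS := comp_continuous cr cS; have clS := comp_continuous cl cS.
have key t : tlift (scalar H (coadjoint_action x a)) id t = tlift (scalar H a) id
   (tlift (fun u => (tensorl \o antipode) u * t) tensorl (coproduct x)).
  apply: (tensor_ext (L' := fun t => tlift (scalar H a) id
   (tlift (fun u => (tensorl \o antipode) u * t) tensorl (coproduct x))) _ _ _ t).
  - by apply: tlift_continuous => //; apply: dual_scalar_continuous.
  - by apply: (continuous_linear_comp cP); apply: sandwich_continuous.
  move=> y z; rewrite tlift_pure //; last exact: dual_scalar_continuous.
  have cda := dual_continuous (dual_in a).
  have cyz : continuous_bilinear (fun u v =>
      (tensorl \o antipode) u * (y \ox z) * tensorl v).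
    apply: mul_continuous_bilinear => //.
    exact: (continuous_linear_comp (continuous_linear_rmul _) clS).
  have cay : continuous_bilinear (fun u v => a (antipode u * y * v) : K^o).
    apply: (comp_continuous_bilinear cda).
    apply: mul_continuous_bilinear => //.
    exact: (continuous_linear_comp (continuous_linear_rmul _) cS).
  rewrite scalar_mul {2}/tlift linear_tsum //.
  rewrite (linear_tsum (L := fun k : K^o => k *: z)) //; last first.
    exact/scale_continuous/continuous_linear_id.
  apply: eq_tsum => u v; rewrite /= /tensorl !pureM mul1r mulr1.
  by rewrite tlift_pure // scalar_mul.
have key2 t : tlift (scalar H a) id
    (tlift (fun u => tensorr u * t) (tensorr \o antipode) (coproduct x)) =
    adjoint_action x (tlift (scalar H a) id t).
  have cad : continuous_linear (adjoint_action x).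
    exact: (sandwich_continuous (coproduct x) cid cS).
  apply: (tensor_ext (L := fun t => tlift (scalar H a) id
    (tlift (fun u => tensorr u * t) (tensorr \o antipode) (coproduct x)))
    (L' := fun t => adjoint_action x (tlift (scalar H a) id t)) _ _ _ t).
  - by apply: (continuous_linear_comp cP); apply: sandwich_continuous.
  - exact: continuous_linear_comp.
  move=> y z; rewrite tlift_pure // scalar_mul linear_continuousZ //.
  rewrite {2}/tlift linear_tsum //; last first.
    apply: mul_continuous_bilinear => //.
    exact: (continuous_linear_comp (continuous_linear_rmul _) cr).
  rewrite /adjoint_action (linear_tsum (L := fun w => a y *: w)); last 2 first.
  - split=> [c u v|W oW]; first by rewrite scalerDr !scalerA mulrC.
    by exists W => // u; apply: opnZ.
  - apply: mul_continuous_bilinear => //; exact: continuous_linear_rmul.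
  apply: eq_tsum => u v; rewrite /= /tensorr !pureM mul1r mulr1.
  by rewrite tlift_pure // scalar_mul.
by rewrite !q_mapE key q_element_ad // key2.
Qed.

End Hopf.

Theorem proposition4p17
    (k : fieldType) (char0 : [pchar k] =i pred0)
    (K : ctRingType) (iota : {rmorphism k -> K})
    (H : hopfAlgType K)
    (separating : forall x : H, (forall a : dual H, a x = 0) -> x = 0)
    (R : (H \ox H)%type) (quasitriangularR : quasitriangular R) :
  [/\ linear (q_map R : dual H -> H),
      q_map R (dual_one H) = 1,
      forall a b : dual H, q_map R (redual_mul R a b) = q_map R a * q_map R b
    & forall (x : H) (a : dual H),
        q_map R (coadjoint_action x a) = adjoint_action x (q_map R a)].
Proof.
split.
- exact: q_map_linear.
- exact: q_map1.
- exact: q_mapM.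
- exact: q_map_coadjoint.
Qed.
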